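(* Let Assumptions A, B and R (see context) hold. Let $\{x_k\}_{k\ge0}$ be generated by the randomized inexact proximal best-response scheme (see context), where for every $i\in\{1,\dots,N\}$ the ($\mathcal F_k$-measurable) inexactness sequence satisfies $0\le\alpha_{i,k}<1$ for all $k$ and $\sum_{k=0}^\infty\alpha_{i,k}<\infty$ almost surely. Then for every $i\in\{1,\dots,N\}$, $\lim_{k\to\infty}x_{i,k}=x_i^*$ almost surely, where $x^*$ is the unique Nash equilibrium of the game.
   Context: Game. There are $N$ players $\mathcal N=\{1,\dots,N\}$. Player $i$ has strategy set $X_i\subseteq\mathbb R^{n_i}$; $X=\prod_i X_i$, $X_{-i}=\prod_{j\ne i}X_j$, $x_{-i}=(x_j)_{j\ne i}$. Let $\xi:\Omega\to\mathbb R^d$ be a random vector on a probability space $(\Omega,\mathcal F,\mathbb P)$. Given $x_{-i}\in X_{-i}$, player $i$ minimizes over $x_i\in X_i$ the function $f_i(x_i,x_{-i})=\mathbb E[\psi_i(x_i,x_{-i};\xi)]$. A Nash equilibrium is a point $x^*\in X$ such that, for every $i$, $x_i^*$ minimizes $f_i(\cdot,x_{-i}^* )$ over $X_i$. $\|\cdot\|$ is the Euclidean norm for vectors and the induced spectral norm for matrices. Assumption A. For every $i$: (a) $X_i$ is closed, compact and convex (nonempty); (b) for every $x_{-i}\in X_{-i}$, $f_i(\cdot,x_{-i})$ is convex and twice continuously differentiable on an open set containing $X_i$; moreover $f_i$ is twice differentiable in $x$ on an open set containing $X$; (c) for all $x_{-i}\in X_{-i}$ and all $\omega\in\Omega$,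 $\psi_i(\cdot,x_{-i};\xi(\omega))$ is differentiable on an open set containing $X_i$, and $\nabla_{x_i}f_i(x_i,x_{-i})=\mathbb E[\nabla_{x_i}\psi_i(x_i,x_{-i};\xi)]$; (d) there is $M_i>0$ with $\mathbb E[\|\nabla_{x_i}\psi_i(x_i,x_{-i};\xi)\|^2]\le M_i^2$ for all $x\in X$. Proximal best-response. Fix $\mu>0$. For $y\in X$, $\hat x_i(y)=\operatorname{argmin}_{x_i\in X_i}\left[f_i(x_i,y_{-i})+\frac{\mu}{2}\|x_i-y_i\|^2\right]$. Matrix $\Gamma$. Let $\zeta_{i,\min}=\inf_{x\in X}\lambda_{\min}(\nabla^2_{x_i}f_i(x))$ and $\zeta_{ij,\max}=\sup_{x\in X}\|\nabla^2_{x_ix_j}f_i(x)\|$ for $j\ne i$, where $\lambda_{\min}(A)$ is the smallest eigenvalue of $(A+A^T)/2$. $\Gamma\in\mathbb R^{N\times N}$ has entries $\Gamma_{ii}=\frac{\mu}{\mu+\zeta_{i,\min}}$ and $\Gamma_{ij}=\frac{\zeta_{ij,\max}}{\mu+\zeta_{i,\min}}$ for $j\neq i$. Assumption B. $\|\Gamma\|<1$. (Under Assumptions A and B the game has a unique Nash equilibrium $x^*$.) Randomized inexact proximal best-response scheme. For each $i$, $\{\chi_{i,k}\}_{k\ge0}$ is an i.i.d. sequence of Bernoulli random variables with values in $\{0,1\}$. Start from $x_{i,0}\in X_i$. At iteration $k=0,1,\dots$, with $x_k=(x_{1,k},\dots,x_{N,k})$: if $\chi_{i,k}=1$, player $i$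 takes an $X_i$-valued $x_{i,k+1}$ with conditional mean-square error at most $\alpha_{i,k}^2$, i.e. $\mathbb E[\|x_{i,k+1}-\hat x_i(x_k)\|^2\mid\sigma(\mathcal F_k,\chi_{i,k})]\le\alpha_{i,k}^2$ almost surely on $\{\chi_{i,k}=1\}$; if $\chi_{i,k}=0$, $x_{i,k+1}=x_{i,k}$. Here $\mathcal F_k$ is the $\sigma$-field of the entire information used by the algorithm up to and including the update of $x_k$ (increasing in $k$; it makes $x_k$ and all $\chi_{j,l}$, $j\in\mathcal N$, $0\le l\le k-1$, measurable), and $\alpha_{i,k}$ is a nonnegative $\mathcal F_k$-measurable random variable. Assumption R. For every $i\in\mathcal N$, $\mathbb P(\chi_{i,k}=1)=p_i>0$ and $\chi_{i,k}$ is independent of $\mathcal F_k$. *)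

(* Defs.v *)
From HB Require Import structures.
From mathcomp Require Export all_boot all_order all_algebra.
From mathcomp Require Export all_classical all_reals all_analysis.
From mathcomp Require Export measurable_realfun.

Set Implicit Arguments.
Unset Strict Implicit.
Unset Printing Implicit Defensive.

Import Order.TTheory GRing.Theory Num.Theory.
Import numFieldNormedType.Exports.

Local Open Scope classical_set_scope.
Local Open Scope ring_scope.

(* The library norm on 'rV[R]_m is the sup norm; it induces the same topology
   and the same notion of differentiability as the Euclidean norm below. *)
Definition enorm (R : realType) (m : nat) (v : 'rV[R]_m) : R :=
  Num.sqrt (\sum_(j < m) v 0 j ^+ 2).

(* v *m A^T is the row-vector form of the product of A with a column vector. *)
Definition opnorm (R : realType) (m q : nat) (A : 'M[R]_(m, q)) : R :=
  sup [set enorm (v *m A^T) | v in [set v : 'rV[R]_q | enorm v <= 1]].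

Definition lambda_min (R : realType) (m : nat) (A : 'M[R]_m) : R :=
  inf [set a : R | eigenvalue (2^-1 *: (A + A^T)) a].

Definition grad (R : realType) (m : nat) (g : 'rV[R]_m -> R) (z : 'rV[R]_m) :
    'rV[R]_m :=
  \row_(j < m) 'D_(delta_mx 0 j) g z.

Definition twice_differentiable_on (R : realType) (m : nat)
    (U : set 'rV[R]_m) (g : 'rV[R]_m -> R) : Prop :=
  forall z, U z -> differentiable g z /\ differentiable (grad g) z.

Definition hessian (R : realType) (m : nat) (g : 'rV[R]_m -> R)
    (z : 'rV[R]_m) : 'M[R]_m :=
  \matrix_(a < m, b < m) 'D_(delta_mx 0 b) (fun z' => grad g z' 0 a) z.

Definition C2_on (R : realType) (m : nat)
    (U : set 'rV[R]_m) (g : 'rV[R]_m -> R) : Prop :=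
  twice_differentiable_on U g /\
  forall z, U z -> {for z, continuous (hessian g)}.

Definition argmin_on (R : realType) (T : Type) (A : set T) (g : T -> R) :
    set T :=
  [set z | A z /\ forall z', A z' -> g z <= g z'].

(* A strategy profile is the concatenation of the blocks x_i in R^(n i). *)
Notation profile R n := 'rV[R]_(\sum_i n i).

Section Game.
Context (R : realType) (N : nat) (n : 'I_N -> nat).
Local Notation profile := (profile R n).

Definition blk (x : profile) (i : 'I_N) : 'rV[R]_(n i) := submxrow x i.

(* The profile (z, x_{-i}). *)
Definition upd (x : profile) (i : 'I_N) (z : 'rV[R]_(n i)) : profile :=
  \mxrow_(j < N) dfwith (fun j => blk x j) i z j.

Definition pgrad (i : 'I_N) (g : profile -> R) (x : profile) :
    'rV[R]_(n i) :=
  grad (fun z => g (upd x z)) (blk x i).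

(* Entry (a, b) is the derivative in coordinate b of x_j of coordinate a of
   the gradient in x_i. *)
Definition phess (i j : 'I_N) (g : profile -> R) (x : profile) :
    'M[R]_(n i, n j) :=
  \matrix_(a < n i, b < n j)
    'D_(delta_mx 0 b) (fun z => pgrad i g (upd x z) 0 a) (blk x j).

Variable X : forall i : 'I_N, set 'rV[R]_(n i).
Arguments X : clear implicits.

Definition feasible : set profile := [set x | forall i, X i (blk x i)].

(* x_{-i} is represented by a full profile whose block i is irrelevant. *)
Definition feasible_others (i : 'I_N) : set profile :=
  [set x | forall j, j != i -> X j (blk x j)].

Variable f : 'I_N -> profile -> R.

Definition is_nash (xs : profile) : Prop :=
  feasible xs /\
  forall i, argmin_on (X i) (fun z => f i (upd xs z)) (blk xs i).

Variable mu : R.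

(* The default value blk y i is irrelevant when the minimizer exists. *)
Definition prox_br (i : 'I_N) (y : profile) : 'rV[R]_(n i) :=
  xget (blk y i)
    (argmin_on (X i)
       (fun z => f i (upd y z) + mu / 2 * enorm (z - blk y i) ^+ 2)).

(* Extended reals, since the real-valued sup and inf are 0 on unbounded sets. *)
Definition zeta_min (i : 'I_N) : \bar R :=
  ereal_inf [set (lambda_min (phess i i (f i) x))%:E | x in feasible].

Definition zeta_max (i j : 'I_N) : \bar R :=
  ereal_sup [set (opnorm (phess i j (f i) x))%:E | x in feasible].

Definition Gamma : 'M[R]_N :=
  \matrix_(i < N, j < N)
    ((if j == i then mu else fine (zeta_max i j)) / (mu + fine (zeta_min i))).

(* The finiteness clauses say that Gamma is a genuine real matrix. *)
Definition assumption_B : Prop :=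
  [/\ forall i, zeta_min i \is a fin_num,
      forall i j, j != i -> zeta_max i j \is a fin_num
    & opnorm Gamma < 1].

End Game.

Section Stochastic.
Context (R : realType) (d : measure_display) (Omega : measurableType d)
  (P : probability Omega R).

Definition sigma_of (dT : measure_display) (T : measurableType dT)
    (Y : Omega -> T) : set (set Omega) :=
  preimage_set_system setT Y measurable.

Definition measurable_wrt (G : set (set Omega)) (dT : measure_display)
    (T : measurableType dT) (Y : Omega -> T) : Prop :=
  sigma_of Y `<=` G.

Definition vec_measurable_wrt (G : set (set Omega)) (m : nat)
    (Y : Omega -> 'rV[R]_m) : Prop :=
  forall j : 'I_m, measurable_wrt G (fun w => Y w 0 j).

Definition is_sub_sigma_algebra (G : set (set Omega)) : Prop :=
  sigma_algebra setT G /\ G `<=` measurable.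

(* Y is a version of E[Z | G], for a nonnegative random variable Z. *)
Definition is_cond_exp (G : set (set Omega)) (Z : Omega -> R)
    (Y : Omega -> \bar R) : Prop :=
  [/\ measurable_fun setT Z /\ (forall w, 0 <= Z w),
      measurable_wrt G Y,
      (forall w, 0 <= Y w)%E
    & forall A, G A -> (\int[P]_(w in A) Y w = \int[P]_(w in A) (Z w)%:E)%E].

Definition independent_of (dT : measure_display) (T : measurableType dT)
    (Y : Omega -> T) (G : set (set Omega)) : Prop :=
  forall (B : set T) (A : set Omega), measurable B -> G A ->
    P (Y @^-1` B `&` A) = (P (Y @^-1` B) * P A)%E.

Definition iid (dT : measure_display) (T : measurableType dT)
    (Y : nat -> Omega -> T) : Prop :=
  [/\ forall k, measurable_fun setT (Y k),
      forall (s : seq nat) (B : nat -> set T), uniq s ->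
        (forall k, measurable (B k)) ->
        P (\bigcap_(k in [set` s]) (Y k @^-1` B k))
          = (\prod_(k <- s) P (Y k @^-1` B k))%E
    & forall (k l : nat) (B : set T), measurable B ->
        P (Y k @^-1` B) = P (Y l @^-1` B)].

Context (N : nat) (n : 'I_N -> nat) (X : forall i : 'I_N, set 'rV[R]_(n i)).
Arguments X : clear implicits.

Section AssumptionA.
Context (m : nat) (xi : Omega -> 'rV[R]_m)
  (psi : 'I_N -> profile R n -> 'rV[R]_m -> R).

Definition cost (i : 'I_N) (x : profile R n) : R :=
  fine 'E_P[fun w => psi i x (xi w)].

(* The expectation defining [cost i x] exists and is finite. *)
Definition cost_defined (i : 'I_N) (x : profile R n) : Prop :=
  P.-integrable setT (fun w => (psi i x (xi w))%:E).

Record assumption_A (i : 'I_N) : Prop := {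
  A_nonempty : X i !=set0 ;
  A_closed : closed (X i) ;
  A_compact : compact (X i) ;
  A_convex : convex_set (X i) ;
  A_own : forall x, feasible_others X i x ->
    exists U : set 'rV[R]_(n i),
      [/\ open U /\ convex_set U, X i `<=` U,
          forall z, U z -> cost_defined i (upd x z),
          convex_function U (fun z => cost i (upd x z))
        & C2_on U (fun z => cost i (upd x z))] ;
  A_joint : exists V : set (profile R n),
    [/\ open V, feasible X `<=` V, forall x, V x -> cost_defined i x
      & twice_differentiable_on V (cost i)] ;
  A_psi_diff : forall x w, feasible_others X i x ->
    exists U : set 'rV[R]_(n i),
      [/\ open U, X i `<=` U
        & forall z, U z -> differentiable (fun z => psi i (upd x z) (xi w)) z] ;
  A_grad : forall x (j : 'I_(n i)), feasible X x ->
    P.-integrable setT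
      (fun w => (pgrad i (fun y => psi i y (xi w)) x ord0 j)%:E) /\
    (pgrad i (cost i) x ord0 j)%:E
      = 'E_P[fun w => pgrad i (fun y => psi i y (xi w)) x ord0 j]%E ;
  A_moment : exists2 M : R, 0 < M & forall x, feasible X x ->
    ('E_P[fun w => (enorm (pgrad i (fun y => psi i y (xi w)) x) ^+ 2)%R]
      <= (M ^+ 2)%:E)%E
}.

End AssumptionA.

Context (f : 'I_N -> profile R n -> R) (mu : R).

(* chi i k w = true encodes chi_{i,k} = 1. *)
Record randomized_scheme (chi : 'I_N -> nat -> Omega -> bool)
    (F : nat -> set (set Omega)) (alpha : 'I_N -> nat -> Omega -> R)
    (x : nat -> Omega -> profile R n) : Prop := {
  S_iid : forall i, iid (chi i) ;
  S_filtration : forall k, is_sub_sigma_algebra (F k) /\ F k `<=` F k.+1 ;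
  S_adapted : forall k, vec_measurable_wrt (F k) (x k) ;
  S_chi_past : forall k j l, (l < k)%N -> measurable_wrt (F k) (chi j l) ;
  S_alpha : forall i k, measurable_wrt (F k) (alpha i k) /\
    forall w, 0 <= alpha i k w ;
  S_init : forall i w, X i (blk (x 0%N w) i) ;
  S_stay : forall i k w, chi i k w = false ->
    blk (x k.+1 w) i = blk (x k w) i ;
  S_move : forall i k w, chi i k w = true -> X i (blk (x k.+1 w) i) ;
  S_error : forall i k, exists2 Y : Omega -> \bar R,
    is_cond_exp <<s F k `|` sigma_of (chi i k) >>
      (fun w => enorm (blk (x k.+1 w) i - prox_br X f mu i (x k w)) ^+ 2) Y
    & {ae P, forall w, chi i k w = true -> (Y w <= (alpha i k w ^+ 2)%:E)%E}
}.

Definition assumption_R (chi : 'I_N -> nat -> Omega -> bool)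
    (F : nat -> set (set Omega)) (p : 'I_N -> R) : Prop :=
  forall i, 0 < p i /\
    forall k, P (chi i k @^-1` [set true]) = (p i)%:E /\
      independent_of (chi i k) (F k).

End Stochastic.

(* Main.v *)
(* Deterministic part. The variational inequalities of the two proximal problems
   at y and y', combined with the mean value theorem for the partial gradient
   along a segment of X, give |xhat_i(y) - xhat_i(y')| <= sum_j Gamma_ij
   |y_j - y'_j|. Hence xhat is a contraction for the Euclidean norm, and its
   fixed point is the unique Nash equilibrium x^*.

   Stochastic part. Let u_{i,k} = |x_{i,k} - x_i^*|. On the move event the error
   is at most e + (Gamma u_k)_i, with e the inexactness, so that
   V_k = sum_i u_{i,k}^2 / p_i satisfies
     E[V_{k+1} | F_k] <= V_k - (1 - |Gamma|^2) |u_k|^2 + K sum_i delta_{i,k},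
   with delta_{i,k} = alpha_{i,k} + 2^-k. Restricted to the decreasing
   F_k-measurable events "the errors up to time k sum to at most a", the last
   terms have a finite total expectation, so telescoping bounds the expected sum
   of |u_k|^2 over these events, without any martingale convergence theorem.
   Almost every outcome lies in all of these events for some integer a. *)
Require Import Defs.
From mathcomp Require Import all_boot all_order all_algebra.
From mathcomp Require Import all_classical all_reals all_analysis.
From mathcomp Require Import measurable_realfun.
From mathcomp Require Import ring lra.

Set Implicit Arguments.
Unset Strict Implicit.
Unset Printing Implicit Defensive.

Import Order.TTheory GRing.Theory Num.Theory.
Import numFieldNormedType.Exports.

Local Open Scope classical_set_scope.
Local Open Scope ring_scope.

(** * Euclidean norms and symmetric matrices *)

Section Euclidean.
Context {R : realType}.

Definition dotv m (u v : 'rV[R]_m) : R := \sum_(j < m) u 0 j * v 0 j.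

Lemma dotvC m (u v : 'rV[R]_m) : dotv u v = dotv v u.
Proof. by apply: eq_bigr => j _; rewrite mulrC. Qed.

Lemma dotvDl m (u u' v : 'rV[R]_m) : dotv (u + u') v = dotv u v + dotv u' v.
Proof. by rewrite /dotv -big_split; apply: eq_bigr => j _; rewrite mxE mulrDl. Qed.

Lemma dotvZl m c (u v : 'rV[R]_m) : dotv (c *: u) v = c * dotv u v.
Proof. by rewrite /dotv mulr_sumr; apply: eq_bigr => j _; rewrite mxE mulrA. Qed.

Lemma dotvDr m (u v v' : 'rV[R]_m) : dotv u (v + v') = dotv u v + dotv u v'.
Proof. by rewrite dotvC dotvDl !(dotvC u). Qed.

Lemma dotvZr m c (u v : 'rV[R]_m) : dotv u (c *: v) = c * dotv u v.
Proof. by rewrite dotvC dotvZl dotvC. Qed.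

Lemma dotvNl m (u v : 'rV[R]_m) : dotv (- u) v = - dotv u v.
Proof. by rewrite -scaleN1r dotvZl mulN1r. Qed.

Lemma dotvNr m (u v : 'rV[R]_m) : dotv u (- v) = - dotv u v.
Proof. by rewrite dotvC dotvNl dotvC. Qed.

Lemma dotv0r m (u : 'rV[R]_m) : dotv u 0 = 0.
Proof. by rewrite -(scale0r 0) dotvZr mul0r. Qed.

Lemma dotv_mulmxl m q (u : 'rV[R]_m) (A : 'M[R]_(m, q)) v :
  dotv (u *m A) v = dotv u (v *m A^T).
Proof.
have dotE k (a b : 'rV[R]_k) : dotv a b = (a *m b^T) 0 0.
  by rewrite mxE; apply: eq_bigr => j _; rewrite mxE.
by rewrite !dotE trmx_mul trmxK mulmxA.
Qed.

Lemma dotv_delta m (u : 'rV[R]_m) j : dotv u (delta_mx 0 j) = u 0 j.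
Proof.
rewrite /dotv (bigD1 j)//= mxE !eqxx mulr1 big1 ?addr0// => k kj.
by rewrite mxE (negbTE kj) andbF mulr0.
Qed.

Lemma enorm_ge0 m (v : 'rV[R]_m) : 0 <= enorm v.
Proof. exact: sqrtr_ge0. Qed.

Lemma enorm_sqr m (v : 'rV[R]_m) : enorm v ^+ 2 = dotv v v.
Proof.
rewrite sqr_sqrtr; first by apply: eq_bigr => j _; rewrite expr2.
by apply: sumr_ge0 => j _; exact: sqr_ge0.
Qed.

Lemma enorm_coord m (v : 'rV[R]_m) j : `|v 0 j| <= enorm v.
Proof.
rewrite -ler_sqr ?nnegrE ?enorm_ge0// enorm_sqr -normrX.
rewrite ger0_norm ?sqr_ge0// /dotv (bigD1 j)//= expr2 lerDl.
by apply: sumr_ge0 => k _; rewrite -expr2 sqr_ge0.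
Qed.

Lemma mxnorm_enorm m (v : 'rV[R]_m) : `|v| <= enorm v.
Proof.
rewrite /Num.Def.normr/= mx_normrE (bigmax_le _ (enorm_ge0 v))// => -[i j] _ /=.
by rewrite ord1; exact: enorm_coord.
Qed.

Lemma enorm_eq0 m (v : 'rV[R]_m) : (enorm v == 0) = (v == 0).
Proof.
apply/eqP/eqP => [v0|->].
  by apply/eqP; rewrite -normr_le0 (le_trans (mxnorm_enorm v))// v0.
by apply/eqP; rewrite -sqrf_eq0 enorm_sqr dotv0r.
Qed.

Lemma enorm0 m : enorm (0 : 'rV[R]_m) = 0.
Proof. by apply/eqP; rewrite enorm_eq0. Qed.

Lemma enormZ m c (v : 'rV[R]_m) : enorm (c *: v) = `|c| * enorm v.
Proof.
apply/eqP; rewrite -(@eqrXn2 _ 2) ?mulr_ge0 ?enorm_ge0// exprMn !enorm_sqr.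
by rewrite dotvZl dotvZr mulrA -normrX ger0_norm ?sqr_ge0 ?expr2.
Qed.

Lemma enormN m (v : 'rV[R]_m) : enorm (- v) = enorm v.
Proof. by rewrite -scaleN1r enormZ normrN1 mul1r. Qed.

(** Cauchy-Schwarz: the squared norm of [enorm v *: u - enorm u *: v] is nonnegative and equals
    [2 * enorm u * enorm v] times the difference of the two sides. *)
Lemma dotv_le_enorm m (u v : 'rV[R]_m) : dotv u v <= enorm u * enorm v.
Proof.
have [u0|u0] := eqVneq u 0.
  by rewrite u0 dotvC dotv0r mulr_ge0 ?enorm_ge0.
have [v0|v0] := eqVneq v 0.
  by rewrite v0 dotv0r mulr_ge0 ?enorm_ge0.
have u1 : 0 < enorm u by rewrite lt_neqAle eq_sym enorm_eq0 u0 enorm_ge0.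
have v1 : 0 < enorm v by rewrite lt_neqAle eq_sym enorm_eq0 v0 enorm_ge0.
have : 0 <= enorm (enorm v *: u - enorm u *: v) ^+ 2 by exact: sqr_ge0.
rewrite enorm_sqr !(dotvDl, dotvDr, dotvNl, dotvNr, dotvZl, dotvZr).
rewrite -!enorm_sqr (dotvC v u).
move: u1 v1; move: (enorm u) (enorm v) (dotv u v) => a b c a0 b0 H.
have ab0 : 0 < 2 * a * b by rewrite !mulr_gt0.
by rewrite -subr_ge0 -(pmulr_rge0 _ ab0); lra.
Qed.

Lemma enorm_le_sqr m (v : 'rV[R]_m) c : 0 <= c -> dotv v v <= c ^+ 2 ->
  enorm v <= c.
Proof. by move=> c0 vc; rewrite -ler_sqr ?nnegrE ?enorm_ge0// enorm_sqr. Qed.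

Lemma enormD m (u v : 'rV[R]_m) : enorm (u + v) <= enorm u + enorm v.
Proof.
apply: enorm_le_sqr; first by rewrite addr_ge0 ?enorm_ge0.
rewrite !(dotvDl, dotvDr) (dotvC v) -!enorm_sqr.
by have := dotv_le_enorm u v; lra.
Qed.

Lemma continuous_coord m (j : 'I_m) : continuous (fun v : 'rV[R]_m => v 0 j).
Proof. by move=> v; exact: coord_continuous. Qed.

Lemma continuous_sumr (T : topologicalType) (I : Type) (r : seq I)
    (g : I -> T -> R) : (forall i, continuous (g i)) ->
  continuous (fun x => \sum_(i <- r) g i x).
Proof.
move=> gc; elim: r => [|i r IH] x.
  by under eq_fun do rewrite big_nil; exact: cst_continuous.
under eq_fun do rewrite big_cons.
by apply: continuousD; [exact: gc|exact: IH].
Qed.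

Lemma continuous_dotv (T : topologicalType) m (g h : T -> 'rV[R]_m) :
  continuous g -> continuous h -> continuous (fun x => dotv (g x) (h x)).
Proof.
move=> gc hc; apply: continuous_sumr => i x.
apply: continuousM.
  exact: (continuous_comp (gc x) (@continuous_coord _ i _)).
exact: (continuous_comp (hc x) (@continuous_coord _ i _)).
Qed.

Lemma continuous_enorm m : continuous (@enorm R m).
Proof.
have -> : @enorm R m = (fun v => Num.sqrt (dotv v v)).
  by apply/funext => w; rewrite -enorm_sqr sqrtr_sqr ger0_norm ?enorm_ge0.
move=> v; apply: continuous_comp; last exact: sqrt_continuous.
by apply: continuous_dotv => w; exact: cvg_id.
Qed.


Lemma enorm_dist m (u v : 'rV[R]_m) : `|enorm u - enorm v| <= enorm (u - v).
Proof.
have H a b : enorm a - enorm b <= enorm (a - b :> 'rV[R]_m).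
  by rewrite lerBlDr -{1}(subrK b a) enormD.
by rewrite ler_norml H andbT lerNl opprB -(enormN (u - v)) opprB H.
Qed.

(** Links the Euclidean norm to the ambient topology of the sup norm: Euclidean balls are
    neighbourhoods. [mxnorm_enorm] gives the converse comparison. *)
Lemma near_enorm_lt m (x : 'rV[R]_m) e :
  0 < e -> \forall y \near x, enorm (x - y) < e.
Proof.
move=> e0; have : {for x, continuous (fun y : 'rV[R]_m => enorm (x - y))}.
  apply: continuous_comp; last exact: continuous_enorm.
  by apply: continuousB; [exact: cst_continuous|exact: cvg_id].
move/cvgrPdist_lt => /(_ e e0); apply: filterS => y.
by rewrite subrr enorm0 sub0r normrN ger0_norm ?enorm_ge0.
Qed.

(** A real supremum is meaningful only for a bounded set. The bound is the Frobenius norm, by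
    Cauchy-Schwarz applied to each row. *)
Lemma opnorm_has_ubound m q (A : 'M[R]_(m, q)) :
  has_ubound [set enorm (v *m A^T) | v in [set v : 'rV[R]_q | enorm v <= 1]].
Proof.
exists (Num.sqrt (\sum_(i < m) enorm (row i A) ^+ 2)) => _ [v /= v1 <-].
apply: ler_wsqrtr; apply: ler_sum => i _.
have -> : (v *m A^T) 0 i = dotv v (row i A).
  by rewrite mxE; apply: eq_bigr => j _; rewrite !mxE.
rewrite -real_normK ?num_real// ler_sqr ?nnegrE ?enorm_ge0//.
have dotv_le w : enorm w <= 1 -> dotv w (row i A) <= enorm (row i A).
  move=> w1; apply: (le_trans (dotv_le_enorm _ _)).
  by rewrite ler_piMl ?enorm_ge0.
by rewrite ler_norml lerNl -dotvNl !dotv_le ?enormN.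
Qed.

Lemma opnorm_ge0 m q (A : 'M[R]_(m, q)) : 0 <= opnorm A.
Proof.
apply: ub_le_sup; first exact: opnorm_has_ubound.
exists 0; last by rewrite mul0mx enorm0.
by rewrite /= enorm0 ler01.
Qed.

Lemma enorm_mulmx_tr m q (A : 'M[R]_(m, q)) (v : 'rV[R]_q) :
  enorm (v *m A^T) <= opnorm A * enorm v.
Proof.
have [->|v0] := eqVneq v 0.
  by rewrite mul0mx !enorm0 mulr0.
have v1 : 0 < enorm v by rewrite lt_neqAle eq_sym enorm_eq0 v0 enorm_ge0.
rewrite -ler_pdivrMr// mulrC.
have -> : (enorm v)^-1 * enorm (v *m A^T) = enorm (((enorm v)^-1 *: v) *m A^T).
  by rewrite -scalemxAl enormZ ger0_norm// invr_ge0 enorm_ge0.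
apply: ub_le_sup; first exact: opnorm_has_ubound.
exists ((enorm v)^-1 *: v) => //=.
by rewrite enormZ ger0_norm ?invr_ge0 ?enorm_ge0// mulVf// gt_eqF.
Qed.

(** Taking [t = - a / (1 + |c|)] makes the linear term outweigh the quadratic one, so the value
    would be negative if [a] were nonzero. *)
Lemma quadratic_ge0_linear0 (a c : R) :
  (forall t, 0 <= t * a + t ^+ 2 * c) -> a = 0.
Proof.
move=> H; have := H (- a / (1 + `|c|)).
have c0 : 0 < 1 + `|c| by rewrite ltr_pwDl.
set d := 1 + `|c| in c0 *.
have -> : - a / d * a + (- a / d) ^+ 2 * c = (a / d) ^+ 2 * (c - d).
  by field; rewrite gt_eqF.
move=> {}H; apply/eqP; apply: contraT => a0.
have: 0 < (a / d) ^+ 2 by rewrite exprn_even_gt0//= mulf_neq0// invr_neq0// gt_eqF.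
move=> /pmulr_rge0 ad; move: H; rewrite ad /d.
by have := ler_norm c; lra.
Qed.

Lemma bounded_enorm m (A : set 'rV[R]_m) (c : R) :
  (forall v, A v -> enorm v <= c) -> bounded_set A.
Proof.
move=> Ac; exists c; split; first exact: num_real.
move=> M cM v /Ac vc; apply: (le_trans (mxnorm_enorm v)).
exact: (le_trans vc (ltW cM)).
Qed.

Lemma enorm_sphere_compact m : compact [set v : 'rV[R]_m | enorm v = 1].
Proof.
apply: bounded_closed_compact.
  by apply: (@bounded_enorm _ _ 1) => v /= ->.
apply: (@closed_comp _ _ (@enorm R m) [set 1]); last exact: closed_eq.
by move=> v _; exact: continuous_enorm.
Qed.

(* The minimum of the Rayleigh quotient is attained, and by first-order
   optimality it is attained at an eigenvector. *)
Lemma symmetric_min_eigenvalue m (S : 'M[R]_m) : (0 < m)%N -> S^T = S ->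
  exists2 a, eigenvalue S a & forall v, a * dotv v v <= dotv (v *m S) v.
Proof.
move=> m0 symS.
have qc : continuous (fun v : 'rV[R]_m => dotv (v *m S) v).
  apply: continuous_sumr => j x; apply: continuousM; last exact: continuous_coord.
  have -> : (fun v : 'rV[R]_m => (v *m S) 0 j) =
      (fun v => \sum_k v 0 k * S k j) by apply/funext => v; rewrite mxE.
  apply: continuous_sumr => k y; apply: continuousM; last exact: cst_continuous.
  exact: continuous_coord.
have [|v0 /set_mem /= v01 v0min] := EVT_min_rV _ (@enorm_sphere_compact m)
    (continuous_subspaceT qc).
  exists (delta_mx 0 (Ordinal m0)) => /=.
  apply/eqP; rewrite -(@eqrXn2 _ 2) ?enorm_ge0// enorm_sqr dotv_delta mxE !eqxx.
  by rewrite expr1n.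
set a := dotv (v0 *m S) v0 in v0min.
have amin v : a * dotv v v <= dotv (v *m S) v.
  have [->|vn0] := eqVneq v 0; first by rewrite !dotv0r mulr0.
  have v1 : 0 < enorm v by rewrite lt_neqAle eq_sym enorm_eq0 vn0 enorm_ge0.
  have /v0min : (enorm v)^-1 *: v \in [set v : 'rV[R]_m | enorm v = 1].
    rewrite inE /= enormZ ger0_norm ?invr_ge0 ?enorm_ge0// mulVf//.
    by rewrite gt_eqF.
  rewrite -scalemxAl dotvZl dotvZr mulrA -expr2 exprVn ler_pdivlMl ?exprn_gt0//.
  by rewrite enorm_sqr mulrC.
exists a => //; apply/eigenvalueP; exists v0; last first.
  by rewrite -enorm_eq0 v01 oner_eq0.
apply/eqP; rewrite -subr_eq0; apply/eqP/rowP => j.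
rewrite -dotv_delta mxE; set w := delta_mx 0 j.
(* Expanding the Rayleigh inequality at [v0 + t *: w] leaves a [t]-linear term equal to twice the
   coordinate that has to vanish; hence the halved quadratic coefficient. *)
apply: (@quadratic_ge0_linear0 _ ((dotv (w *m S) w - a * dotv w w) / 2)) => t.
have := amin (v0 + t *: w).
rewrite !(mulmxDl, dotvDl, dotvDr, dotvNl, dotvZl, dotvZr, =^~ scalemxAl) -/a.
rewrite (dotvC w v0) (dotv_mulmxl w) symS (dotvC w (v0 *m S)).
have -> : dotv v0 v0 = 1 by rewrite -enorm_sqr v01 expr1n.
lra.
Qed.

Lemma dotv_mulmx_sym m (A : 'M[R]_m) v :
  dotv (v *m (2^-1 *: (A + A^T))) v = dotv (v *m A) v.
Proof.
rewrite -scalemxAr dotvZl mulmxDr dotvDl (dotv_mulmxl v A^T) trmxK.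
by rewrite (dotvC v); lra.
Qed.

(** The least Rayleigh quotient is an eigenvalue and bounds all eigenvalues from below, so the
    infimum is genuine and cannot exceed it. *)
Lemma lambda_min_le m (A : 'M[R]_m) v :
  (0 < m)%N -> lambda_min A * dotv v v <= dotv (v *m A) v.
Proof.
move=> m0; rewrite -dotv_mulmx_sym; set S := 2^-1 *: (A + A^T).
have symS : S^T = S by rewrite /S linearZ linearD /= trmxK addrC.
have [a eig amin] := symmetric_min_eigenvalue m0 symS.
apply: le_trans (amin v); apply: ler_wpM2r; first by rewrite -enorm_sqr sqr_ge0.
apply: ge_inf => //; exists a => b /= /eigenvalueP[w wS w0].
have := amin w; rewrite wS dotvZl ler_pM2r// -enorm_sqr.
by rewrite exprn_gt0// lt_neqAle eq_sym enorm_eq0 w0 enorm_ge0.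
Qed.

Lemma lambda_min_ge0 m (A : 'M[R]_m) : (0 < m)%N ->
  (forall v, 0 <= dotv (v *m A) v) -> 0 <= lambda_min A.
Proof.
move=> m0 A0; have symS : (2^-1 *: (A + A^T))^T = 2^-1 *: (A + A^T).
  by rewrite linearZ linearD /= trmxK addrC.
apply: lb_le_inf.
  by have [a eig _] := symmetric_min_eigenvalue m0 symS; exists a.
move=> b /= /eigenvalueP[w wS w0].
have := A0 w; rewrite -dotv_mulmx_sym wS dotvZl pmulr_lge0// -enorm_sqr.
by rewrite exprn_gt0// lt_neqAle eq_sym enorm_eq0 w0 enorm_ge0.
Qed.

End Euclidean.

(** * Directional derivatives and convexity *)

Section Calculus.
Context {R : realType}.

Lemma derive_dotv_grad m (g : 'rV[R]_m -> R) z v :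
  differentiable g z -> 'D_v g z = dotv v (grad g z).
Proof.
move=> dg; rewrite deriveE// {1}(row_sum_delta v) linear_sum.
by apply: eq_bigr => j _; rewrite linearZ mxE deriveE.
Qed.

Lemma differentiable_grad_coord m (g : 'rV[R]_m -> R) z a :
  differentiable (grad g) z -> differentiable (fun y => grad g y 0 a) z.
Proof.
move=> dg; exact: (differentiable_comp dg (differentiable_coord _ _ _)).
Qed.

Lemma is_derive_dotv_grad m (g : 'rV[R]_m -> R) z u v :
  differentiable (grad g) z ->
  is_derive z v (fun y => dotv u (grad g y)) (dotv (u *m hessian g z) v).
Proof.
move=> dg.
have -> : (fun y => dotv u (grad g y)) =
    \sum_(a < m) (u 0 a *: (fun y => grad g y 0 a) : 'rV[R]_m -> R).
  by apply/funext => y; rewrite fct_sumE.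
have -> : dotv (u *m hessian g z) v =
    \sum_(a < m) u 0 a *: 'D_v (fun y => grad g y 0 a) z.
  rewrite dotvC dotvC dotv_mulmxl; apply: eq_bigr => a _.
  rewrite derive_dotv_grad; last exact: differentiable_grad_coord.
  by congr (_ * _); rewrite mxE; apply: eq_bigr => b _; rewrite !mxE.
apply: is_derive_sum => a; apply: is_deriveZ; apply: derivableP.
exact/diff_derivable/differentiable_grad_coord.
Qed.

(** Turns a directional derivative into the derivative of a function of one real variable, as the
    mean value theorem requires. *)
Lemma is_derive_line (V : normedModType R) (g : V -> R) z v (t : R) :
  derivable g (t *: v + z) v ->
  is_derive t 1 (fun s => g (s *: v + z)) ('D_v g (t *: v + z)).
Proof.
have E : (fun h : R => h^-1 *:
      (((fun s => g (s *: v + z)) \o shift t) (h *: 1) - g (t *: v + z))) =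
    (fun h => h^-1 *: ((g \o shift (t *: v + z)) (h *: v) - g (t *: v + z))).
  by apply/funext => h /=; rewrite -[h *: 1]/(h * 1) mulr1 scalerDl addrA.
by move=> dg; split; rewrite /derivable /derive /= E.
Qed.

(** The right difference quotients are at least [a + t * b], which tends to [a]. The term in [b]
    leaves room for the quadratic remainder of the proximal penalty. *)
Lemma derive_ge_linear (V : normedModType R) (g : V -> R) z v (a b e : R) :
  derivable g z v -> 0 < e ->
  (forall t, 0 < t < e -> t * a + t ^+ 2 * b <= g (t *: v + z) - g z) ->
  a <= 'D_v g z.
Proof.
move=> dg e0 H.
have cd : (fun h => h^-1 *: ((g \o shift z) (h *: v) - g z)) @ 0^'+ --> 'D_v g z.
  apply: cvg_trans dg; apply: cvg_app.
  by apply: within_subset => r ?; rewrite gt_eqF.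
have cl : (fun h : R => a + h * b) @ 0^'+ --> a.
  rewrite -[X in _ --> X]addr0; apply: cvgD; first exact: cvg_cst.
  rewrite -[X in _ --> X](mul0r b); apply: cvgM; last exact: cvg_cst.
  by apply: cvg_at_right_filter; exact: cvg_id.
apply: (ler_cvg_to cl cd); near=> h.
have h0 : 0 < h by near: h; exact: nbhs_right_gt.
have he : h < e by near: h; exact: nbhs_right_lt.
rewrite -[leRHS]/(h^-1 * (g (h *: v + z) - g z)) ler_pdivlMl//.
apply: le_trans (H h _); last by rewrite h0 he.
by rewrite le_eqVlt; apply/orP; left; apply/eqP; ring.
Unshelve. all: by end_near. Qed.

Lemma convex_functionP (V : normedModType R) (U : set V) (g : V -> R) x y t :
  convex_function U g -> U x -> U y -> 0 <= t <= 1 ->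
  g (t *: (y - x) + x) <= g x + t * (g y - g x).
Proof.
move=> cg Ux Uy t01.
have /andP[t0 t1] := t01.
have := cg (Itv01 t0 t1) y x (mem_set Uy) (mem_set Ux).
rewrite -[leRHS]/(t * g y + (1 - t) * g x).
rewrite -[conv _ _ _]/(t *: y + (1 - t) *: x).
have -> : t *: (y - x) + x = t *: y + (1 - t) *: x.
  by rewrite scalerBr scalerBl scale1r -addrA (addrC x).
by move/le_trans; apply; lra.
Qed.

Lemma convex_setP (V : normedModType R) (U : set V) x y t :
  convex_set U -> U x -> U y -> 0 <= t <= 1 -> U (t *: (y - x) + x).
Proof.
move=> cU Ux Uy /andP[t0 t1].
have := cU y x (Itv01 t0 t1) (mem_set Uy) (mem_set Ux).
rewrite inE -[conv _ _ _]/(t *: y + (1 - t) *: x).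
suff -> : t *: y + (1 - t) *: x = t *: (y - x) + x by [].
by rewrite scalerBr scalerBl scale1r -addrA (addrC x).
Qed.

(** Convexity keeps the graph below the chord, so [derive_ge_linear] applies to [- g] with no
    quadratic term. *)
Lemma convex_derive_le (V : normedModType R) (U : set V) (g : V -> R) x y :
  convex_function U g -> U x -> U y -> derivable g x (y - x) ->
  'D_(y - x) g x <= g y - g x.
Proof.
move=> cg Ux Uy dg; rewrite -lerN2 -deriveN//.
apply: (@derive_ge_linear _ (- g) x (y - x) (- (g y - g x)) 0 1).
- exact: derivableN.
- exact: ltr01.
move=> t /andP[t0 t1]; rewrite mulr0 addr0.
have t01 : 0 <= t <= 1 by rewrite !ltW.
have := convex_functionP cg Ux Uy t01.
by rewrite !fctE; lra.
Qed.

(** Adding the tangent inequalities at [z] and at [t *: v + z] shows that the gradient is monotone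
    along [v]. The Hessian form is the derivative of the gradient paired with [v]. *)
Lemma convex_hessian_ge0 m (U : set 'rV[R]_m) (g : 'rV[R]_m -> R) z v :
  open U -> convex_function U g -> twice_differentiable_on U g -> U z ->
  0 <= dotv (v *m hessian g z) v.
Proof.
move=> oU cg dg Uz; have [_ dgz] := dg z Uz.
have [dd <-] := is_derive_dotv_grad v v dgz.
have [e e0 Ue] : exists2 e, 0 < e & forall t, 0 < t < e -> U (t *: v + z).
  have : \forall t \near (0 : R), U (t *: v + z).
    have : {for 0, continuous (fun t : R => t *: v + z)}.
      apply: cvgD; last exact: cvg_cst.
      by apply: cvgZr_tmp; exact: cvg_id.
    by apply; rewrite /= scale0r add0r; exact: open_nbhs_nbhs.
  move=> /nbhs_ballP[e /= e0 He]; exists e => // t /andP[t0 te].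
  by apply: He; rewrite /ball /= sub0r normrN gtr0_norm.
apply: (@derive_ge_linear _ _ _ _ _ 0 e) => // t te.
have /andP[t0 _] := te.
have Ut := Ue _ te; have [dgt _] := dg _ Ut; have [dg0 _] := dg _ Uz.
have := convex_derive_le cg Uz Ut (diff_derivable dg0).
have := convex_derive_le cg Ut Uz (diff_derivable dgt).
rewrite !derive_dotv_grad//.
have -> : t *: v + z - z = t *: v by rewrite addrK.
have -> : z - (t *: v + z) = - (t *: v) by rewrite opprD addrCA subrr addr0.
rewrite dotvNl !dotvZl mulr0 mulr0 addr0 => A B.
by rewrite -(pmulr_rge0 _ t0); lra.
Qed.

End Calculus.

(** * Block calculus *)

Section Blocks.
Context {R : realType} {N : nat} {n : 'I_N -> nat}.
Implicit Types (x y : profile R n) (i j : 'I_N).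

Lemma blkE x i a : blk x i 0 a = x 0 (tagnat.Rank i a).
Proof. by rewrite mxE. Qed.

Lemma blkP x y : (forall j, blk x j = blk y j) -> x = y.
Proof. by move=> H; apply/mxrowP. Qed.

Lemma blk_upd_in x i z : blk (upd x z) i = z.
Proof. by rewrite /blk mxrowK dfwithin. Qed.

Lemma blk_upd_out x i z j : j != i -> blk (upd x (i := i) z) j = blk x j.
Proof. by move=> ji; rewrite /blk mxrowK dfwithout// eq_sym. Qed.

Lemma blkD x y j : blk (x + y) j = blk x j + blk y j.
Proof. exact: submxrowD. Qed.

Lemma blkN x j : blk (- x) j = - blk x j.
Proof. exact: submxrowN. Qed.

Lemma blkZ c x j : blk (c *: x) j = c *: blk x j.
Proof. by apply/rowP => a; rewrite !mxE. Qed.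

Lemma blk0 j : blk (0 : profile R n) j = 0.
Proof. exact: submxrow0. Qed.

Lemma upd_blk x i : upd x (blk x i) = x.
Proof.
apply: blkP => j; have [->|ji] := eqVneq j i; first by rewrite blk_upd_in.
by rewrite blk_upd_out.
Qed.

Lemma upd_upd x i z z' : upd (upd x (i := i) z') (i := i) z = upd x z.
Proof.
apply: blkP => j; have [->|ji] := eqVneq j i; first by rewrite !blk_upd_in.
by rewrite !blk_upd_out.
Qed.

Lemma upd_line x i z v t :
  upd x (i := i) (t *: v + z) = t *: upd 0 v + upd x z.
Proof.
apply: blkP => j; rewrite blkD blkZ; have [->|ji] := eqVneq j i.
  by rewrite !blk_upd_in.
by rewrite !blk_upd_out// blk0 scaler0 add0r.
Qed.

Lemma upd0_delta i a :
  upd (0 : profile R n) (delta_mx 0 a) = delta_mx 0 (tagnat.Rank i a).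
Proof.
apply: blkP => j; apply/rowP => b; rewrite [RHS]blkE [RHS]mxE eqxx /=.
rewrite -(inj_eq val_inj) tagnat.eq_Rank.
have [ji|ji] := eqVneq j i; last by rewrite blk_upd_out// blk0 mxE.
by case: _ / (esym ji) b => b; rewrite blk_upd_in mxE eqxx.
Qed.

Lemma sum_blocks (F : 'I_(\sum_i n i) -> R) :
  \sum_k F k = \sum_j \sum_(b < n j) F (tagnat.Rank j b).
Proof.
by rewrite sig_big_dep/= (reindex _ tagnat.rank_bij_on)/=; apply: eq_bigr => -[].
Qed.

Lemma dotv_blocks x y : dotv x y = \sum_j dotv (blk x j) (blk y j).
Proof.
rewrite /dotv sum_blocks; apply: eq_bigr => j _; apply: eq_bigr => b _.
by rewrite !blkE.
Qed.

(** Lives in the space ['rV[R]_N] on which [Gamma] acts; passing to block norms preserves the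
    Euclidean norm, by [enorm_bnorm]. *)
Definition bnorm x : 'rV[R]_N := \row_j enorm (blk x j).

Lemma enorm_bnorm x : enorm (bnorm x) = enorm x.
Proof.
apply/eqP; rewrite -(@eqrXn2 _ 2) ?enorm_ge0// !enorm_sqr dotv_blocks.
by apply/eqP/eq_bigr => j _; rewrite mxE -expr2 enorm_sqr.
Qed.

Lemma enorm_blk x j : enorm (blk x j) <= enorm x.
Proof.
rewrite -(enorm_bnorm x); apply: le_trans (enorm_coord (bnorm x) j).
by rewrite mxE ler_norm.
Qed.

Lemma continuous_blk j : continuous (fun x => blk x j).
Proof.
move=> x; have ? := nbhs_filter x; apply/cvgrPdist_lt => e e0.
apply: filterS (near_enorm_lt x e0) => y xy.
apply: le_lt_trans xy; apply: le_trans (mxnorm_enorm _) _.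
by rewrite -blkN -blkD enorm_blk.
Qed.

(** Since [upd x] is affine with linear part [upd 0], both difference quotients are the same
    function of the step. *)
Lemma derive_upd (W : normedModType R) (g : profile R n -> W) x i z v :
  'D_v (fun z => g (upd x z)) z = 'D_(upd 0 v) g (upd x (i := i) z).
Proof.
rewrite /derive; set F := (F in F @ _); set G := (F in _ = lim (F @ _)).
have -> // : F = G.
by apply/funext => h; rewrite /F /G /= upd_line.
Qed.

Lemma pgradE i (g : profile R n -> R) x : pgrad i g x = blk (grad g x) i.
Proof.
by apply/rowP => a; rewrite blkE !mxE derive_upd upd_blk upd0_delta.
Qed.

Lemma phessE i j (g : profile R n -> R) x a b :
  phess i j g x a b = hessian g x (tagnat.Rank i a) (tagnat.Rank j b).
Proof.
rewrite !mxE (derive_upd (fun y => pgrad i g y 0 a)) upd_blk upd0_delta.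
have -> // : (fun y => pgrad i g y 0 a) = (fun y => grad g y 0 (tagnat.Rank i a)).
by apply/funext => y; rewrite pgradE blkE.
Qed.

Lemma pgrad_upd i (g : profile R n -> R) x z :
  pgrad i g (upd x z) = grad (fun z => g (upd x z)) z.
Proof.
rewrite /pgrad blk_upd_in.
have -> // : (fun z' : 'rV_(n i) => g (upd (upd x z) z')) =
    (fun z => g (upd x z)).
by apply/funext => z'; rewrite upd_upd.
Qed.

Lemma phess_own i (g : profile R n -> R) x :
  phess i i g x = hessian (fun z => g (upd x z)) (blk x i).
Proof.
apply/matrixP => a b; rewrite [LHS]mxE [RHS]mxE.
have -> // : (fun z => pgrad i g (upd x z) 0 a) =
    (fun z => grad (fun z => g (upd x z)) z 0 a).
by apply/funext => z; rewrite pgrad_upd.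
Qed.

Lemma dotv_upd0 i v y : dotv (upd 0 (i := i) v) y = dotv v (blk y i).
Proof.
rewrite dotv_blocks (bigD1 i)//= blk_upd_in big1 ?addr0// => j ji.
by rewrite blk_upd_out// blk0 dotvC dotv0r.
Qed.

Lemma blk_mulmx_hessian i j (g : profile R n -> R) x v :
  blk (upd 0 (i := i) v *m hessian g x) j = v *m phess i j g x.
Proof.
apply/rowP => b; rewrite blkE.
pose c : profile R n := \row_k hessian g x k (tagnat.Rank j b).
have -> : (upd 0 v *m hessian g x) 0 (tagnat.Rank j b) = dotv (upd 0 v) c.
  by rewrite mxE; apply: eq_bigr => k _; rewrite [c _ _]mxE.
rewrite dotv_upd0 mxE; apply: eq_bigr => a _.
by rewrite blkE [c _ _]mxE phessE.
Qed.

(** Padding [v] with zero blocks replaces the partial gradient by the full one; the resulting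
    Hessian form is then split along the blocks of [D]. *)
Lemma is_derive_dotv_pgrad i (g : profile R n -> R) x v D :
  differentiable (grad g) x ->
  is_derive x D (fun y => dotv v (pgrad i g y))
    (\sum_j dotv (v *m phess i j g x) (blk D j)).
Proof.
move=> dg; have -> : (fun y => dotv v (pgrad i g y)) =
    (fun y => dotv (upd 0 v) (grad g y)).
  by apply/funext => y; rewrite dotv_upd0 pgradE.
have -> : \sum_j dotv (v *m phess i j g x) (blk D j) =
    dotv (upd 0 v *m hessian g x) D.
  by rewrite dotv_blocks; apply: eq_bigr => j _; rewrite blk_mulmx_hessian.
exact: is_derive_dotv_grad.
Qed.

End Blocks.

(** * The proximal best response map *)

Section Game.
Context {R : realType} {N : nat} {n : 'I_N -> nat}.
Variables (X : forall i : 'I_N, set 'rV[R]_(n i)) (f : 'I_N -> profile R n -> R).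
Arguments X : clear implicits.

(** The content of Assumption A on which the deterministic part relies, for arbitrary costs [f].
    Positive block dimensions ensure that each symmetrized own Hessian has a real eigenvalue. *)
Record smooth_convex_game : Prop := {
  game_dim : forall i, (0 < n i)%N ;
  game_nonempty : forall i, X i !=set0 ;
  game_compact : forall i, compact (X i) ;
  game_convex : forall i, convex_set (X i) ;
  game_own : forall i x, feasible X x -> exists U : set 'rV[R]_(n i),
    [/\ open U, X i `<=` U, convex_function U (fun z => f i (upd x z))
      & twice_differentiable_on U (fun z => f i (upd x z))] ;
  game_joint : forall i, exists V : set (profile R n),
    feasible X `<=` V /\ twice_differentiable_on V (f i)
}.

Context (HG : smooth_convex_game).

Lemma feasible_upd x i z : feasible X x -> X i z -> feasible X (upd x z).
Proof.
move=> Xx Xz j; have [->|ji] := eqVneq j i; first by rewrite blk_upd_in.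
by rewrite blk_upd_out.
Qed.

Lemma feasible_line x y t : feasible X x -> feasible X y -> 0 <= t <= 1 ->
  feasible X (t *: (y - x) + x).
Proof.
move=> Xx Xy t01 j; rewrite blkD blkZ blkD blkN.
by apply: convex_setP => //; exact: (game_convex HG).
Qed.

Lemma feasible_bounded : exists C, forall x, feasible X x -> enorm x <= C.
Proof.
have H i : {M | forall z, X i z -> enorm z <= M}.
  have cX : compact (X i) by exact: (game_compact HG).
  apply: cid; have := EVT_max_rV (game_nonempty HG i) cX
    (continuous_subspaceT (@continuous_enorm R (n i))).
  by move=> [z _ zmax]; exists (enorm z) => w Xw; apply: zmax; rewrite inE.
exists (Num.sqrt (\sum_i sval (H i) ^+ 2)) => x Xx.
rewrite -enorm_bnorm; apply: ler_wsqrtr; apply: ler_sum => i _.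
have Hi := svalP (H i) _ (Xx i).
rewrite [bnorm x _ _]mxE ler_sqr ?nnegrE ?enorm_ge0//.
exact: le_trans (enorm_ge0 _) Hi.
Qed.

Lemma compact_feasible : compact (feasible X).
Proof.
have [C XC] := feasible_bounded.
apply: bounded_closed_compact; first exact: bounded_enorm XC.
have -> : feasible X = \bigcap_(i in [set: 'I_N]) ((fun x => blk x i) @^-1` X i).
  by apply/seteqP; split => [x Xx i _ |x Xx i]; [exact: Xx|exact: Xx].
apply: closed_bigI => i _; apply: closed_comp.
  by move=> x _; exact: continuous_blk.
by apply: compact_closed; [exact: norm_hausdorff|exact: (game_compact HG)].
Qed.

Lemma feasible_neq0 : feasible X !=set0.
Proof.
have [z Xz] : {z : forall i, 'rV[R]_(n i) | forall i, X i (z i)}.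
  exists (fun i => sval (cid (game_nonempty HG i))) => i.
  exact: svalP (cid (game_nonempty HG i)).
by exists (\mxrow_j z j) => j; rewrite /blk mxrowK.
Qed.

Lemma phess_own_ge0 i x v : feasible X x ->
  0 <= dotv (v *m phess i i (f i) x) v.
Proof.
move=> Xx; rewrite phess_own.
have [U [oU XU cU dU]] := game_own HG i Xx.
by apply: convex_hessian_ge0 oU cU dU _; apply: XU; exact: Xx.
Qed.

Context (zeta_min_fin : forall i, zeta_min X f i \is a fin_num).
Context (zeta_max_fin : forall i j, j != i -> zeta_max X f i j \is a fin_num).

(** Comes from convexity in the own strategy, and makes the denominators of [Gamma] positive. *)
Lemma zeta_min_ge0 i : 0 <= fine (zeta_min X f i).
Proof.
apply: fine_ge0; apply: le_ereal_inf_tmp => _ [x Xx <-]; rewrite lee_fin.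
apply: lambda_min_ge0; first exact: (game_dim HG).
by move=> v; exact: phess_own_ge0.
Qed.

Lemma zeta_min_le i x v : feasible X x ->
  fine (zeta_min X f i) * dotv v v <= dotv (v *m phess i i (f i) x) v.
Proof.
move=> Xx; apply: le_trans (lambda_min_le _ _ (game_dim HG i)).
apply: ler_wpM2r; first by rewrite -enorm_sqr sqr_ge0.
by rewrite -lee_fin fineK//; apply: ereal_inf_lbound; exists x.
Qed.

Lemma zeta_max_ge i j x u v : j != i -> feasible X x ->
  - (fine (zeta_max X f i j) * enorm u * enorm v) <=
  dotv (u *m phess i j (f i) x) v.
Proof.
move=> ji Xx; rewrite dotv_mulmxl.
have op_le : opnorm (phess i j (f i) x) <= fine (zeta_max X f i j).
  rewrite -lee_fin fineK; last exact: zeta_max_fin.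
  by apply: ereal_sup_ubound; exists x.
rewrite lerNl -dotvNl; apply: le_trans (dotv_le_enorm _ _) _.
rewrite enormN mulrAC mulrC; apply: ler_wpM2r; first exact: enorm_ge0.
apply: le_trans (enorm_mulmx_tr _ _) _.
by apply: ler_wpM2r => //; exact: enorm_ge0.
Qed.

(** Pairing with the fixed vector [blk D i] gives a scalar function on the segment, so the mean
    value theorem produces a single intermediate point. There the own Hessian block is bounded by
    [zeta_min] and the cross blocks by [zeta_max]. *)
Lemma pgrad_increment_ge i y y' : feasible X y -> feasible X y' ->
  fine (zeta_min X f i) * enorm (blk (y - y') i) ^+ 2
    - (\sum_(j | j != i) fine (zeta_max X f i j) * enorm (blk (y - y') j))
      * enorm (blk (y - y') i)
  <= dotv (blk (y - y') i) (pgrad i (f i) y - pgrad i (f i) y').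
Proof.
move=> Xy Xy'; set D := y - y'.
pose phi (t : R) := dotv (blk D i) (pgrad i (f i) (t *: D + y')).
pose dphi (t : R) :=
  \sum_j dotv (blk D i *m phess i j (f i) (t *: D + y')) (blk D j).
have [V [XV dV]] := game_joint HG i.
have dphiP (t : R) : 0 <= t <= 1 -> is_derive t 1 phi (dphi t).
  move=> t01; have [_] := dV _ (XV _ (feasible_line Xy' Xy t01)).
  rewrite -/D => dg.
  rewrite /dphi; case: (is_derive_dotv_pgrad (blk D i) D dg) => dd <-.
  exact: (is_derive_line (g := fun y => dotv (blk D i) (pgrad i (f i) y))).
have [||t t01] := @MVT R phi dphi 0 1 ltr01.
- move=> t; rewrite in_itv/= => /andP[t0 t1]; apply: dphiP.
  by rewrite !ltW.
- apply: derivable_within_continuous => t; rewrite in_itv/= => t01.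
  by have [] := dphiP t t01.
rewrite subr0 mulr1 /phi scale1r scale0r add0r subrK.
rewrite -dotvNr -dotvDr => ->; rewrite /dphi [leRHS](bigD1 i)//=.
have Xt : feasible X (t *: D + y').
  apply: feasible_line => //; move: t01; rewrite in_itv/= => /andP[t0 t1].
  by rewrite !ltW.
apply: lerD; first by rewrite enorm_sqr; exact: zeta_min_le.
rewrite mulr_suml -sumrN; apply: ler_sum => j ji.
apply: le_trans (zeta_max_ge _ _ ji Xt).
by rewrite lerN2 mulrAC.
Qed.


Lemma zeta_max_ge0 i j : j != i -> 0 <= fine (zeta_max X f i j).
Proof.
move=> ji; have [x Xx] := feasible_neq0.
apply: fine_ge0; apply: le_trans (ereal_sup_ubound _); last by exists x.
by rewrite lee_fin opnorm_ge0.
Qed.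

(** * First-order conditions, contraction and Nash equilibrium *)

Context (mu : R) (mu_gt0 : 0 < mu).

Definition prox_objective i y (z : 'rV[R]_(n i)) : R :=
  f i (upd y z) + mu / 2 * enorm (z - blk y i) ^+ 2.

Lemma prox_variational i y z w : feasible X y ->
  argmin_on (X i) (prox_objective y) z -> X i w ->
  0 <= dotv (w - z) (pgrad i (f i) (upd y z))
       + mu * dotv (w - z) (z - blk y i).
Proof.
move=> Xy [Xz zmin] Xw; have [U [oU XU cU dU]] := game_own HG i Xy.
have [dz _] := dU _ (XU _ Xz).
rewrite pgrad_upd -derive_dotv_grad// -lerBlDr sub0r.
apply: (@derive_ge_linear _ _ _ _ _ _ (- (mu / 2 * dotv (w - z) (w - z))) 1).
- exact: diff_derivable.
- exact: ltr01.
- move=> t /andP[t0 t1].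
  have /zmin : X i (t *: (w - z) + z).
    by apply: convex_setP => //; [exact: (game_convex HG)|rewrite !ltW].
  rewrite /prox_objective -addrA !enorm_sqr.
  rewrite (dotvDl (t *: _)) (dotvDr (t *: _)) (dotvDr (z - _) (t *: _)).
  rewrite (dotvC (z - _) (t *: _)) !dotvZl dotvZr.
  by move: (dotv _ _) (dotv _ _) (dotv _ _) => A B C; lra.
Qed.

(** Each minimizer serves as the competitor in the variational inequality of the other. Their sum is
    confronted with [pgrad_increment_ge] at [upd y z] and [upd y' z'], and Cauchy-Schwarz handles
    the proximal centers. *)
Lemma prox_lipschitz i y y' z z' : feasible X y -> feasible X y' ->
  argmin_on (X i) (prox_objective y) z ->
  argmin_on (X i) (prox_objective y') z' ->
  (mu + fine (zeta_min X f i)) * enorm (z - z') <=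
  \sum_j (if j == i then mu else fine (zeta_max X f i j)) *
    enorm (blk (y - y') j).
Proof.
move=> Xy Xy' zmin zmin'.
have vi := prox_variational Xy zmin zmin'.1.
have vi' := prox_variational Xy' zmin' zmin.1.
have := pgrad_increment_ge i (feasible_upd Xy zmin.1) (feasible_upd Xy' zmin'.1).
rewrite blkD blkN !blk_upd_in.
rewrite (eq_bigr (fun j => fine (zeta_max X f i j) * enorm (blk (y - y') j)));
  last by move=> j ji; rewrite blkD blkN !blk_upd_out// -blkN -blkD.
move=> mono; rewrite (bigD1 i)//= eqxx.
rewrite (eq_bigr (fun j => fine (zeta_max X f i j) * enorm (blk (y - y') j)));
  last by move=> j /negbTE ->.
set S := \sum_(j | j != i) _ in mono *.
have S0 : 0 <= S.
  by apply: sumr_ge0 => j ji; rewrite mulr_ge0 ?enorm_ge0 ?zeta_max_ge0.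
have CS : dotv (z - z') (blk (y - y') i) <=
    enorm (z - z') * enorm (blk (y - y') i) by exact: dotv_le_enorm.
have [->|d0] := eqVneq (enorm (z - z')) 0.
  by rewrite mulr0 addr_ge0// mulr_ge0 ?enorm_ge0// ltW.
have d1 : 0 < enorm (z - z') by rewrite lt_neqAle eq_sym d0 enorm_ge0.
rewrite -(ler_pM2r d1).
have sq := enorm_sqr (z - z').
(* All inner products are expanded with the common left factor [z - z']; what remains is linear in
   the monomials that occur. *)
have E : z' - z = - (z - z') by rewrite opprB.
rewrite E !dotvNl !(dotvDr (z - z')) !dotvNr in vi.
rewrite (dotvDr (z - z') z') !dotvNr in vi'.
rewrite (dotvDr (z - z') (pgrad _ _ _)) dotvNr in mono.
rewrite blkD blkN (dotvDr (z - z')) dotvNr -blkN -blkD in CS.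
rewrite (dotvDr (z - z') z) dotvNr in sq.
have muCS := ler_wpM2l (ltW mu_gt0) CS.
have musq := congr1 (fun r => mu * r) sq.
move: vi vi' mono muCS musq; rewrite /=.
move: (dotv _ (pgrad _ _ (upd y z))) (dotv _ (pgrad _ _ (upd y' z'))) => G G'.
move: (dotv _ z) (dotv _ z') (dotv _ (blk y i)) (dotv _ (blk y' i)) => p q r s.
move: (enorm _) (enorm _) (fine _) S S0 => e h k S _.
lra.
Qed.

Definition xhat y : profile R n := \mxrow_i prox_br X f mu i y.

Lemma blk_xhat y i : blk (xhat y) i = prox_br X f mu i y.
Proof. by rewrite /blk mxrowK. Qed.

(** A continuous objective attains its minimum on the compact [X i], so the default value in
    [prox_br] is never returned. *)
Lemma prox_brP i y : feasible X y ->
  argmin_on (X i) (prox_objective y) (prox_br X f mu i y).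
Proof.
move=> Xy; rewrite /prox_br; apply: xgetPex.
have [U [oU XU cU dU]] := game_own HG i Xy.
have gc : {within X i, continuous (@prox_objective i y)}.
  apply: continuous_in_subspaceT => z /set_mem Xz.
  have [dz _] := dU _ (XU _ Xz).
  rewrite /prox_objective.
  have ? := nbhs_filter z.
  apply: cvgD; first exact: differentiable_continuous.
  apply: cvgM; first exact: cvg_cst.
  have hc : continuous (fun w : 'rV[R]_(n i) => enorm (w - blk y i)).
    move=> w; apply: continuous_comp; last exact: continuous_enorm.
    by apply: continuousB; [exact: cvg_id|exact: cst_continuous].
  exact: (cvg_comp _ _ (hc z) (@exprn_continuous R 2 _)).
have cX : compact (X i) by exact: (game_compact HG).
have [z /set_mem Xz zmin] := EVT_min_rV (game_nonempty HG i) cX gc.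
by exists z; split => // w Xw; apply: zmin; rewrite inE.
Qed.

Lemma feasible_xhat y : feasible X y -> feasible X (xhat y).
Proof. by move=> Xy i; rewrite blk_xhat; have [] := prox_brP i Xy. Qed.

(** Dividing [prox_lipschitz] by [mu + fine (zeta_min X f i)] produces row [i] of [Gamma]. Allowing
    arbitrary minimizers also gives their uniqueness, by taking [y = y']. *)
Lemma argmin_prox_contraction i y y' z z' : feasible X y -> feasible X y' ->
  argmin_on (X i) (prox_objective y) z ->
  argmin_on (X i) (prox_objective y') z' ->
  enorm (z - z') <= (bnorm (y - y') *m (Gamma X f mu)^T) 0 i.
Proof.
move=> Xy Xy' zmin zmin'.
have m0 : 0 < mu + fine (zeta_min X f i) by rewrite ltr_pwDl ?zeta_min_ge0.
rewrite -(ler_pM2l m0); apply: le_trans (prox_lipschitz Xy Xy' zmin zmin') _.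
rewrite mxE mulr_sumr; apply: ler_sum => j _; rewrite !mxE.
rewrite le_eqVlt; apply/orP; left; apply/eqP.
move: (enorm _) (if _ then _ else _) (mu + _) m0 => e g a a0.
by field; rewrite gt_eqF.
Qed.

Lemma xhat_contraction y y' : feasible X y -> feasible X y' ->
  enorm (xhat y - xhat y') <= opnorm (Gamma X f mu) * enorm (y - y').
Proof.
move=> Xy Xy'; rewrite -[X in _ * X]enorm_bnorm.
apply: le_trans (enorm_mulmx_tr _ _); rewrite -enorm_bnorm.
apply: ler_wsqrtr; apply: ler_sum => i _.
have H := argmin_prox_contraction Xy Xy' (prox_brP i Xy) (prox_brP i Xy').
have E : bnorm (xhat y - xhat y') 0 i =
    enorm (prox_br X f mu i y - prox_br X f mu i y').
  by rewrite mxE blkD blkN !blk_xhat.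
by rewrite E ler_sqr ?nnegrE ?enorm_ge0//; exact: le_trans (enorm_ge0 _) H.
Qed.

(** At an equilibrium the penalty vanishes, so each block also minimizes the proximal objective,
    whose minimizer is unique. At a fixed point the proximal term leaves the variational inequality,
    and the tangent inequality turns the rest into optimality. *)
Lemma is_nash_fixpoint xs : feasible X xs ->
  is_nash X f xs <-> xhat xs = xs.
Proof.
move=> Xxs; split=> [[_ nash]|fix_xs].
  apply: blkP => i; rewrite blk_xhat.
  have minx : argmin_on (X i) (prox_objective xs) (blk xs i).
    have [Xi mini] := nash i; split=> // w Xw.
    rewrite /prox_objective subrr enorm0 expr0n mulr0 addr0.
    apply: le_trans (mini w Xw) _; rewrite lerDl mulr_ge0//.
      by rewrite divr_ge0// ltW.
    by rewrite sqr_ge0.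
  have := argmin_prox_contraction Xxs Xxs (prox_brP i Xxs) minx.
  have -> : bnorm (xs - xs) = 0.
    by apply/rowP => j; rewrite !mxE subrr blk0 enorm0.
  rewrite mul0mx mxE => H; apply/eqP; rewrite -subr_eq0 -enorm_eq0.
  by rewrite eq_le H enorm_ge0.
split=> // i; split=> [|w Xw]; first exact: Xxs.
have minx := prox_brP i Xxs; rewrite -blk_xhat fix_xs in minx.
have := prox_variational Xxs minx Xw.
rewrite subrr dotv0r mulr0 addr0 pgrad_upd => H.
have [U [oU XU cU dU]] := game_own HG i Xxs.
have [dz _] := dU _ (XU _ (Xxs i)).
rewrite -derive_dotv_grad// in H; rewrite -subr_ge0; apply: le_trans H _.
exact: (convex_derive_le cU (XU _ (Xxs i)) (XU _ Xw) (diff_derivable dz)).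
Qed.

Context (Gamma_lt1 : opnorm (Gamma X f mu) < 1).

Lemma xhat_fixpoint_unique y y' : feasible X y -> feasible X y' ->
  xhat y = y -> xhat y' = y' -> y = y'.
Proof.
move=> Xy Xy' fy fy'; have := xhat_contraction Xy Xy'; rewrite fy fy' => H.
apply/eqP; rewrite -subr_eq0 -enorm_eq0 eq_le enorm_ge0 andbT.
have := enorm_ge0 (y - y'); move: H Gamma_lt1; nra.
Qed.

(** The displacement [F] attains a minimum on the compact feasible set. As [xhat] shrinks [F] by the
    factor [c < 1], the minimum is zero. *)
Lemma xhat_fixpoint : exists2 xs, feasible X xs & xhat xs = xs.
Proof.
pose c := opnorm (Gamma X f mu); have c1 : c < 1 := Gamma_lt1.
pose F y := enorm (xhat y - y).
have Fc : {within feasible X, continuous F}.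
  apply/subspace_continuousP => y Xy; apply/cvgrPdist_lt => e e0.
  (* [F] is Lipschitz with constant [1 + c], which is below 2. *)
  have e2 : 0 < e / 2 by rewrite divr_gt0.
  apply: filterS (near_enorm_lt y e2) => z yz Xz.
  apply: le_lt_trans (enorm_dist _ _) _.
  have -> : xhat y - y - (xhat z - z) = xhat y - xhat z + - (y - z).
    by rewrite !opprB addrACA [RHS]addrACA (addrC (- y)).
  apply: le_lt_trans (enormD _ _) _; rewrite enormN.
  have H := xhat_contraction Xy Xz; rewrite -/c in H.
  by have := enorm_ge0 (y - z); nra.
have [y /set_mem Xy ymin] := EVT_min_rV feasible_neq0 compact_feasible Fc.
exists y => //; apply/eqP; rewrite -subr_eq0 -enorm_eq0 -/(F y).
have := ymin _ (mem_set (feasible_xhat Xy)).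
have := xhat_contraction (feasible_xhat Xy) Xy; rewrite -/c -!/(F _) => H1 H2.
rewrite eq_le enorm_ge0 andbT.
by have := enorm_ge0 (xhat y - y); rewrite -/(F y); nra.
Qed.

Lemma unique_nash : exists2 xs, feasible X xs & xhat xs = xs /\
  is_nash X f xs /\ forall ys, is_nash X f ys -> ys = xs.
Proof.
have [xs Xxs fxs] := xhat_fixpoint; exists xs => //; split => //; split.
  exact/is_nash_fixpoint.
move=> ys nys; have Xys := nys.1.
by apply: xhat_fixpoint_unique => //; exact/is_nash_fixpoint.
Qed.

End Game.

(** * Conditional expectations weighted by adapted variables *)

Section SubSigmaAlgebra.
Context {d : measure_display} {Omega : measurableType d}.
Context (G : set (set Omega)) (sG : is_sub_sigma_algebra G).

Lemma g_sigma_algebra_measurable (A : set (g_sigma_algebraType G)) :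
  measurable A -> G A.
Proof. by rewrite /measurable/= (sigma_algebra_id sG.1). Qed.

(** Makes the closure properties of measurable functions available for [G], seen as the
    sigma-algebra of [g_sigma_algebraType G]. *)
Lemma measurable_wrtP d' (T : measurableType d') (Y : Omega -> T) :
  measurable_wrt G Y <->
  measurable_fun (setT : set (g_sigma_algebraType G)) (Y : g_sigma_algebraType G -> T).
Proof.
have GE : <<s G >> = G := sigma_algebra_id sG.1.
split=> [mY _ B mB|mY _ [B mB <-]].
  by rewrite /measurable/= GE; apply: mY; exists B.
by have := mY measurableT B mB; rewrite /measurable/= GE.
Qed.

Lemma measurable_wrt_measurable d' (T : measurableType d') (Y : Omega -> T) :
  measurable_wrt G Y -> measurable_fun setT Y.
Proof. by move=> mY _ B mB; apply: sG.2; apply: mY; exists B. Qed.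

Lemma measurable_wrt_sub (H : set (set Omega)) d' (T : measurableType d')
  (Y : Omega -> T) : G `<=` H -> measurable_wrt G Y -> measurable_wrt H Y.
Proof. by move=> GH mY A /mY /GH. Qed.

End SubSigmaAlgebra.

(** * Integral inequalities with weights measurable for a sub-sigma-algebra *)

Section WeightedIntegral.
Context {R : realType} {d : measure_display} {Omega : measurableType d}.
Context (P : probability Omega R).
Context (G : set (set Omega)) (sG : is_sub_sigma_algebra G).
Import HBNNSimple.

Lemma measurable_nnsfun_preimage
    (h : {nnsfun (g_sigma_algebraType G) >-> R}) (y : R) : G (h @^-1` [set y]).
Proof. apply: (g_sigma_algebra_measurable sG); exact: measurable_sfunP. Qed.

Lemma measurable_nnsfun_sub (h : {nnsfun (g_sigma_algebraType G) >-> R}) :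
  measurable_fun setT (h : Omega -> R).
Proof.
apply: (measurable_wrt_measurable sG); apply/(measurable_wrtP sG).
exact: measurable_funP.
Qed.

Lemma integral_weight_nnsfun (Z : Omega -> R)
    (h : {nnsfun (g_sigma_algebraType G) >-> R}) :
  measurable_fun setT Z -> (forall w, 0 <= Z w) ->
  (\int[P]_w (Z w * h w)%:E =
   \sum_(y \in range h) y%:E * \int[P]_(w in h @^-1` [set y]) (Z w)%:E)%E.
Proof.
move=> mZ Z0.
have mh y : measurable (h @^-1` [set y] : set Omega).
  exact/sG.2/measurable_nnsfun_preimage.
have mi y : measurable_fun setT (fun w : Omega => (y * \1_(h @^-1` [set y]) w)%:E).
  by apply/measurable_EFinP; apply: measurable_funM => //; exact: measurable_indic.
have mE : measurable_fun setT (fun w => (Z w)%:E) by exact/measurable_EFinP.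
transitivity (\int[P]_w (\sum_(y \in range h)
    (y * \1_(h @^-1` [set y]) w)%:E * (Z w)%:E))%E.
  apply: eq_integral => w _; rewrite mulrC EFinM {1}(fimfunE h w) -fsumEFin//.
  by rewrite ge0_mule_fsuml// => y; exact: nnfun_muleindic_ge0.
rewrite ge0_integral_fsum//; last 2 first.
- by move=> y; exact: emeasurable_funM.
- by move=> y w _; rewrite mule_ge0 ?lee_fin// -lee_fin EFinM nnfun_muleindic_ge0.
apply: eq_fsbigr => y /[!inE] -[w _ <-].
under eq_integral do rewrite EFinM -muleA.
rewrite ge0_integralZl//; last 3 first.
- by apply: emeasurable_funM => //; apply/measurable_EFinP; exact: measurable_indic.
- by move=> v _; rewrite mule_ge0 ?lee_fin.
- by rewrite lee_fin.
congr (_ * _)%E; rewrite [RHS]integral_mkcond; apply: eq_integral => v _.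
by rewrite epatch_indic /= muleC.
Qed.

Lemma integral_weight_lim (Z W : Omega -> R)
    (mW : measurable_fun (setT : set (g_sigma_algebraType G)) (EFin \o W))
    (h := nnsfun_approx measurableT mW) :
  measurable_fun setT Z -> (forall w, 0 <= Z w) -> (forall w, 0 <= W w) ->
  (\int[P]_w (Z w * W w)%:E = limn (fun n => \int[P]_w (Z w * h n w)%:E))%E.
Proof.
move=> mZ Z0 W0; rewrite -monotone_convergence//; last 3 first.
- move=> n; apply/measurable_EFinP; apply: measurable_funM => //.
  exact: measurable_nnsfun_sub.
- by move=> n w _; rewrite lee_fin mulr_ge0.
- move=> w _ m n mn; rewrite lee_fin ler_wpM2l//.
  by have /lefP := nd_nnsfun_approx measurableT mW mn; exact.
apply: eq_integral => w _; apply/esym/cvg_lim => //.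
under eq_fun do rewrite EFinM; rewrite EFinM; apply: cvgeZl => //.
have W0' : forall v : g_sigma_algebraType G, setT v -> (0 <= (EFin \o W) v)%E.
  by move=> v _; rewrite lee_fin.
exact: (cvg_nnsfun_approx measurableT mW W0').
Qed.

(** The comparison on events of [G] extends to simple weights, whose level sets lie in [G], and then
    to [W] by monotone convergence. It stands in for pulling a [G]-measurable factor out of a
    conditional expectation. *)
Lemma le_integral_weight (Z Z' W : Omega -> R) :
  measurable_fun setT Z -> measurable_fun setT Z' ->
  (forall w, 0 <= Z w) -> (forall w, 0 <= Z' w) ->
  measurable_wrt G W -> (forall w, 0 <= W w) ->
  (forall A, G A ->
    \int[P]_(w in A) (Z w)%:E <= \int[P]_(w in A) (Z' w)%:E)%E ->
  (\int[P]_w (Z w * W w)%:E <= \int[P]_w (Z' w * W w)%:E)%E.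
Proof.
move=> mZ mZ' Z0 Z'0 /(measurable_wrtP sG) /measurable_EFinP mW W0 ZZ'.
rewrite !(integral_weight_lim mW)//.
set h := nnsfun_approx _ _.
have nd (Q : Omega -> R) : (forall w, 0 <= Q w) -> measurable_fun setT Q ->
    cvgn (fun n => \int[P]_w (Q w * h n w)%:E)%E.
  move=> Q0 mQ; apply: ereal_nondecreasing_is_cvgn => m n mn.
  have mQh k : measurable_fun setT (fun w => (Q w * h k w)%:E).
    apply/measurable_EFinP; apply: measurable_funM => //.
    exact: measurable_nnsfun_sub.
  apply: ge0_le_integral => // w _; rewrite lee_fin ?mulr_ge0//.
  rewrite ler_wpM2l//.
  by have /lefP := nd_nnsfun_approx measurableT mW mn; exact.
apply: lee_lim; [exact: nd|exact: nd|].
apply: nearW => n; rewrite !integral_weight_nnsfun//.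
apply: lee_fsum => // y [w _ <-].
by rewrite lee_wpmul2l ?lee_fin//; apply: ZZ'; exact: measurable_nnsfun_preimage.
Qed.

Lemma eq_integral_weight (Z Z' W : Omega -> R) :
  measurable_fun setT Z -> measurable_fun setT Z' ->
  (forall w, 0 <= Z w) -> (forall w, 0 <= Z' w) ->
  measurable_wrt G W -> (forall w, 0 <= W w) ->
  (forall A, G A ->
    \int[P]_(w in A) (Z w)%:E = \int[P]_(w in A) (Z' w)%:E)%E ->
  (\int[P]_w (Z w * W w)%:E = \int[P]_w (Z' w * W w)%:E)%E.
Proof.
move=> mZ mZ' Z0 Z'0 mW W0 E; apply/eqP; rewrite eq_le.
by apply/andP; split; apply: le_integral_weight => // A /E ->.
Qed.

(** The hypothesis says that [\1_D] and the constant [q] have equal integrals over every event of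
    [G]; hence they may be exchanged under the weight [W]. *)
Lemma integral_weight_independent (D : set Omega) (q : R) (W : Omega -> R) :
  measurable D -> 0 <= q ->
  (forall A, G A -> P (D `&` A) = q%:E * P A)%E ->
  measurable_wrt G W -> (forall w, 0 <= W w) ->
  (\int[P]_w (\1_D w * W w)%:E = q%:E * \int[P]_w (W w)%:E)%E.
Proof.
move=> mD q0 indep mW W0.
rewrite (@eq_integral_weight \1_D (cst q))//.
- under eq_integral do rewrite EFinM.
  rewrite /= ge0_integralZl//; last by move=> w _; rewrite lee_fin.
  by apply/measurable_EFinP; exact: measurable_wrt_measurable mW.
- move=> A GA; have mA := sG.2 _ GA.
  by rewrite integral_indic//= integral_cst// -indep.
Qed.

Lemma sub_sigma_algebra_sigma_of d' (T : measurableType d') (B : Omega -> T) :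
  measurable_fun setT B ->
  is_sub_sigma_algebra <<s G `|` sigma_of B >>.
Proof.
move=> mB; split; first exact: smallest_sigma_algebra.
apply: smallest_sub; first exact: sigma_algebra_measurable.
move=> A [/sG.2//|[E mE <-]]; exact: mB.
Qed.

(** For [A] in [G], the event [A] intersected with [D] belongs to the sigma-algebra generated by [G]
    and [B]. There [Y] integrates like [Z], and it is almost surely at most [al ^+ 2]. *)
Lemma le_integral_cond_exp (B : Omega -> bool) (Z al : Omega -> R)
    (Y : Omega -> \bar R) (W : Omega -> R) (D := B @^-1` [set true]) :
  measurable_fun setT B ->
  is_cond_exp P <<s G `|` sigma_of B >> Z Y ->
  {ae P, forall w, B w = true -> (Y w <= (al w ^+ 2)%:E)%E} ->
  measurable_fun setT al ->
  measurable_wrt G W -> (forall w, 0 <= W w) ->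
  (\int[P]_w ((\1_D w * Z w) * W w)%:E <=
   \int[P]_w ((\1_D w * al w ^+ 2) * W w)%:E)%E.
Proof.
move=> mB [[mZ Z0] mY Y0 ZY] Yal mal mW W0.
have mD : measurable D by rewrite -[X in measurable X]setTI; exact: mB.
have m1D : measurable_fun setT (\1_D : Omega -> R) by exact: measurable_indic.
have mal2 : measurable_fun setT (fun w => al w ^+ 2) by exact: measurable_funX.
have restr (Q : Omega -> R) A : (\int[P]_(w in A) (\1_D w * Q w)%:E =
    \int[P]_(w in A `&` D) (Q w)%:E)%E.
  rewrite [RHS]integral_mkcondr; apply: eq_integral => w _.
  by rewrite epatch_indic /= muleC -EFinM.
apply: le_integral_weight => //.
- exact: measurable_funM.
- exact: measurable_funM.
- by move=> w; rewrite mulr_ge0.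
- by move=> w; rewrite mulr_ge0// sqr_ge0.
move=> A GA; rewrite !restr; have mA := sG.2 _ GA.
have HA : <<s G `|` sigma_of B >> (A `&` D).
  apply: (@measurableI _ (g_sigma_algebraType (G `|` sigma_of B))).
    by apply: sub_sigma_algebra; left.
  apply: sub_sigma_algebra; right; exists [set true] => //.
  by rewrite setTI.
rewrite -ZY//; have mAD : measurable (A `&` D) by exact: measurableI.
apply: ae_ge0_le_integral => //.
- apply: measurable_funTS.
  exact: (measurable_wrt_measurable (sub_sigma_algebra_sigma_of mB)).
- by move=> w _; rewrite lee_fin sqr_ge0.
- by apply: measurable_funTS; exact/measurable_EFinP.
- by apply: filterS Yal => w H [_ Bw]; exact: H.
Qed.

(* Writing delta = alpha + eps, Young's inequality
   2 e g <= C (e^2 / delta + delta) replaces the conditional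
   Cauchy-Schwarz inequality; eps keeps the denominator positive. *)
Lemma one_step_le (B : Omega -> bool) (p : R) (e al u u' g : Omega -> R)
    (Y : Omega -> \bar R) (S : set Omega) (a C eps : R) :
  measurable_fun setT B -> P (B @^-1` [set true]) = p%:E ->
  independent_of P B G ->
  is_cond_exp P <<s G `|` sigma_of B >> (fun w => e w ^+ 2) Y ->
  {ae P, forall w, B w = true -> (Y w <= (al w ^+ 2)%:E)%E} ->
  measurable_wrt G al -> measurable_wrt G u -> measurable_wrt G g ->
  measurable_fun setT u' -> G S ->
  (forall w, 0 <= e w) -> (forall w, 0 <= al w) ->
  (forall w, 0 <= u' w) -> (forall w, 0 <= g w <= C) ->
  0 < eps -> (forall w, S w -> al w <= a) -> 0 <= a ->
  (forall w, B w = false -> u' w = u w) ->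
  (forall w, B w = true -> u' w <= e w + g w) ->
  (\int[P]_w (u' w ^+ 2 * \1_S w)%:E <=
   (1 - p)%:E * \int[P]_w (u w ^+ 2 * \1_S w)%:E +
   p%:E * \int[P]_w ((g w ^+ 2 + (a + 2 * C) * (al w + eps)) * \1_S w)%:E)%E.
Proof.
move=> mB PB indep condY Yal mal mu mg mu' GS e0 al0 u'0 gC eps0 ala a0.
move=> stay moves.
have g0 w : 0 <= g w by have /andP[] := gC w.
have C0 : 0 <= C by have /andP[] := gC point; exact: le_trans.
have [[me2 _] _ _ _] := condY.
have toG Q : measurable_fun (setT : set (g_sigma_algebraType G)) Q ->
  @measurable_wrt _ Omega G _ (measurableTypeR R) Q by move/(measurable_wrtP sG).
have ofG Q : @measurable_wrt _ Omega G _ (measurableTypeR R) Q ->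
  measurable_fun (setT : set (g_sigma_algebraType G)) Q by move/(measurable_wrtP sG).
have GO Q : @measurable_wrt _ Omega G _ (measurableTypeR R) Q ->
  measurable_fun (setT : set Omega) Q by exact: measurable_wrt_measurable.
have mS : measurable_wrt G (\1_S : Omega -> R).
  apply/toG; apply: measurable_indic.
  by rewrite /measurable/= (sigma_algebra_id sG.1).
pose delta w := al w + eps.
have delta0 w : 0 < delta w by rewrite ltr_wpDl.
have mdelta : measurable_wrt G delta.
  by apply/toG; apply: measurable_funD => //; exact: ofG.
have mdeltaV : measurable_wrt G (fun w => (delta w)^-1).
  have -> : (fun w => (delta w)^-1) = (fun w => powR (delta w) (-1)).
    by apply/funext => w; rewrite powR_inv1// ltW.
  apply/toG; exact: (measurableT_comp (@measurable_powR R (-1)) (ofG _ mdelta)).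
pose D1 := B @^-1` [set true]; pose D0 := B @^-1` [set false].
have mD1 : measurable D1 by rewrite -[X in measurable X]setTI; exact: mB.
have mD0 : measurable D0 by rewrite -[X in measurable X]setTI; exact: mB.
(* On a move, Young's inequality bounds [(e + g) ^+ 2] by [(1 + C / delta) * e ^+ 2 + C * delta + g
   ^+ 2]: [W] is the coefficient of [e ^+ 2] and [V] the rest, both cut to [S]. [U] is the value
   when the player stays. *)
pose W w := (1 + C / delta w) * \1_S w.
pose V w := (C * delta w + g w ^+ 2) * \1_S w.
pose U w := u w ^+ 2 * \1_S w.
have mW : measurable_wrt G W.
  apply/toG/measurable_funM; last exact: ofG.
  by apply: measurable_funD => //; apply: measurable_funM => //; exact: ofG.
have mV : measurable_wrt G V.
  apply/toG/measurable_funM; last exact: ofG.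
  apply: measurable_funD; first by apply: measurable_funM => //; exact: ofG.
  by apply: measurable_funX; exact: ofG.
have mU : measurable_wrt G U.
  apply/toG/measurable_funM; last exact: ofG.
  by apply: measurable_funX; exact: ofG.
have W0 w : 0 <= W w.
  by rewrite mulr_ge0// addr_ge0// divr_ge0// ltW.
have V0 w : 0 <= V w.
  by rewrite mulr_ge0// addr_ge0 ?sqr_ge0// mulr_ge0// ltW.
have U0 w : 0 <= U w by rewrite mulr_ge0 ?sqr_ge0.
have pge0 : 0 <= p by rewrite -lee_fin -PB.
have PD0 : P D0 = (1 - p)%:E.
  have -> : D0 = ~` D1.
    by apply/seteqP; split => w; rewrite /D0 /D1 /=; case: (B w).
  by rewrite probability_setC// /D1 PB.
have p1 : 0 <= 1 - p by rewrite -lee_fin -PD0.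
have le1 : (\int[P]_w (u' w ^+ 2 * \1_S w)%:E <=
    \int[P]_w (\1_D0 w * U w)%:E + \int[P]_w ((\1_D1 w * e w ^+ 2) * W w)%:E
    + \int[P]_w (\1_D1 w * V w)%:E)%E.
  have m1 : measurable_fun setT (fun w => (\1_D0 w * U w)%:E).
    apply/measurable_EFinP/measurable_funM; last exact: GO.
    exact: measurable_indic.
  have m2 : measurable_fun setT (fun w => ((\1_D1 w * e w ^+ 2) * W w)%:E).
    apply/measurable_EFinP/measurable_funM; last exact: GO.
    by apply: measurable_funM => //; exact: measurable_indic.
  have m3 : measurable_fun setT (fun w => (\1_D1 w * V w)%:E).
    apply/measurable_EFinP/measurable_funM; last exact: GO.
    exact: measurable_indic.
  have n1 w : (0 <= (\1_D0 w * U w)%:E)%E by rewrite lee_fin mulr_ge0.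
  have n2 w : (0 <= ((\1_D1 w * e w ^+ 2) * W w)%:E)%E.
    by rewrite lee_fin mulr_ge0// mulr_ge0// sqr_ge0.
  have n3 w : (0 <= (\1_D1 w * V w)%:E)%E by rewrite lee_fin mulr_ge0.
  rewrite -ge0_integralD// -ge0_integralD//; last 2 first.
  - by move=> w _; rewrite adde_ge0.
  - exact: emeasurable_funD.
  apply: ge0_le_integral => //.
  - by move=> w _; rewrite lee_fin mulr_ge0// sqr_ge0.
  - apply/measurable_EFinP/measurable_funM; first exact: measurable_funX.
    exact: GO.
  - by apply: emeasurable_funD => //; exact: emeasurable_funD.
  move=> w _; rewrite -!EFinD lee_fin /U /V /W.
  set s := \1_S w; have s0 : 0 <= s by [].
  case Bw : (B w).
    have -> : \1_D1 w = 1 :> R by rewrite indicE mem_set.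
    have -> : \1_D0 w = 0 :> R by rewrite indicE memNset// /D0 /= Bw.
    rewrite mul0r add0r !mul1r !mulrA -mulrDl ler_wpM2r//.
    have um := moves _ Bw; have /andP[gw0 gwC] := gC w.
    have r0 : 0 < (delta w)^-1 by rewrite invr_gt0.
    have rd : (delta w)^-1 * delta w = 1 by rewrite mulVf// gt_eqF.
    have young : 2 * e w <= e w ^+ 2 * (delta w)^-1 + delta w.
      have : 0 <= (delta w)^-1 * (e w - delta w) ^+ 2.
        by rewrite mulr_ge0 ?sqr_ge0// ltW.
      have -> : (delta w)^-1 * (e w - delta w) ^+ 2 = e w ^+ 2 * (delta w)^-1
          - 2 * e w * ((delta w)^-1 * delta w)
          + ((delta w)^-1 * delta w) * delta w by ring.
      by rewrite rd; lra.
    have u2 : u' w ^+ 2 <= (e w + g w) ^+ 2 by rewrite ler_sqr ?nnegrE ?addr_ge0.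
    apply: le_trans u2 _.
    have cross : 2 * e w * g w <= C * (e w ^+ 2 * (delta w)^-1 + delta w).
      apply: le_trans (ler_wpM2l _ gwC) _; first by rewrite mulr_ge0.
      by rewrite mulrC ler_wpM2l.
    move: cross; move: (delta w)^-1 => r; move: (delta w) => q.
    by move=> cross; lra.
  have -> : \1_D1 w = 0 :> R by rewrite indicE memNset// /D1 /= Bw.
  have -> : \1_D0 w = 1 :> R by rewrite indicE mem_set.
  by rewrite !mul0r mul1r !addr0 stay.
apply: le_trans le1 _.
have indep1 A : G A -> (P (D1 `&` A) = p%:E * P A)%E.
  by move=> GA; rewrite indep// PB.
have indep0 A : G A -> (P (D0 `&` A) = (1 - p)%:E * P A)%E.
  by move=> GA; rewrite indep// PD0.
rewrite (integral_weight_independent mD1 pge0 indep1 mV V0).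
rewrite (integral_weight_independent mD0 p1 indep0 mU U0).
rewrite -addeA leeD2l//.
(* [e] is controlled only conditionally on the move, so it is first replaced by the [G]-measurable
   [al]; independence can then factor out [p]. *)
have := le_integral_cond_exp mB condY Yal (GO _ mal) mW W0.
rewrite -/D1 => le2; apply: le_trans (leeD2r _ le2) _.
under eq_integral do rewrite -mulrA.
have al2W0 w : 0 <= al w ^+ 2 * W w by rewrite mulr_ge0 ?sqr_ge0.
have mal2W : measurable_wrt G (fun w => al w ^+ 2 * W w).
  apply/toG/measurable_funM; last exact: ofG.
  by apply: measurable_funX; exact: ofG.
rewrite (integral_weight_independent mD1 pge0 indep1 mal2W al2W0).
rewrite -ge0_muleDr; last 2 first.
- by apply: integral_ge0 => w _; rewrite lee_fin.
- by apply: integral_ge0 => w _; rewrite lee_fin.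
have mal2WE : measurable_fun setT (fun w => (al w ^+ 2 * W w)%:E).
  by apply/measurable_EFinP; exact: GO.
have mVE : measurable_fun setT (fun w => (V w)%:E).
  by apply/measurable_EFinP; exact: GO.
rewrite lee_wpmul2l ?lee_fin// -ge0_integralD//; last 2 first.
- by move=> w _; rewrite lee_fin.
- by move=> w _; rewrite lee_fin.
apply: ge0_le_integral => //.
- by move=> w _; rewrite -EFinD lee_fin addr_ge0.
- exact: emeasurable_funD.
- apply/measurable_EFinP/GO/toG/measurable_funM; last exact: ofG.
  apply: measurable_funD; first by apply: measurable_funX; exact: ofG.
  by apply: measurable_funM => //; exact: ofG.
move=> w _; rewrite -EFinD lee_fin /W /V mulrA -mulrDl.
have [Sw|Sw] := pselect (S w); last first.
  by have -> : \1_S w = 0 :> R; [rewrite indicE memNset|rewrite !mulr0].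
apply: ler_wpM2r => //.
have alw := al0 w; have alaw := ala _ Sw.
have r0 : 0 < (delta w)^-1 by rewrite invr_gt0.
have ald : al w <= delta w by rewrite /delta; lra.
(* Origin of [a + 2 * C]: the squared error contributes [a * delta], its multiple by [C / delta] at
   most [C * delta], and [V] another [C * delta]. *)
have h1 : al w ^+ 2 <= a * delta w.
  by rewrite expr2; exact: ler_pM.
have h2 : al w ^+ 2 / delta w <= delta w.
  by rewrite ler_pdivrMr// -expr2 ler_sqr ?nnegrE// ltW.
have := ler_wpM2l C0 h2; rewrite -/(delta w).
move: h1; move: (delta w)^-1 => r; move: (delta w) => q.
lra.
Qed.

End WeightedIntegral.

(** * Almost sure convergence of the scheme *)

Section BoundedExpectation.
Context {R : realType} {d : measure_display} {Omega : measurableType d}.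
Context (P : probability Omega R).
Implicit Types h : Omega -> R.

Definition bounded_measurable h :=
  measurable_fun setT h /\ exists M, forall w, `|h w| <= M.

Lemma bounded_measurable_integrable h :
  bounded_measurable h -> P.-integrable setT (EFin \o h).
Proof.
move=> [mh [M hM]]; apply: measurable_bounded_integrable => //.
  by apply: (@le_lt_trans _ _ 1%E); [rewrite le_eqVlt; apply/orP; left;
    apply/eqP; exact: probability_setT|rewrite ltry].
by exists M; split; [exact: num_real|move=> x Mx w _; exact: le_trans (hM w) (ltW Mx)].
Qed.

Lemma EFin_Rintegral h : bounded_measurable h ->
  ((\int[P]_w h w)%:E = \int[P]_w (h w)%:E)%E.
Proof.
move=> bh; rewrite /Rintegral fineK//.
exact/integrable_fin_num/bounded_measurable_integrable.
Qed.

Lemma bounded_measurableD h1 h2 : bounded_measurable h1 ->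
  bounded_measurable h2 -> bounded_measurable (fun w => h1 w + h2 w).
Proof.
move=> [m1 [M1 H1]] [m2 [M2 H2]]; split; first exact: measurable_funD.
by exists (M1 + M2) => w; rewrite (le_trans (ler_normD _ _))// lerD.
Qed.

Lemma bounded_measurableM h1 h2 : bounded_measurable h1 ->
  bounded_measurable h2 -> bounded_measurable (fun w => h1 w * h2 w).
Proof.
move=> [m1 [M1 H1]] [m2 [M2 H2]]; split; first exact: measurable_funM.
by exists (M1 * M2) => w; rewrite normrM ler_pM.
Qed.

Lemma bounded_measurable_cst c : bounded_measurable (fun=> c).
Proof. by split; [exact: measurable_cst|exists `|c|]. Qed.

Lemma bounded_measurable_sum (I : Type) (r : seq I) (h : I -> Omega -> R) :
  (forall i, bounded_measurable (h i)) ->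
  bounded_measurable (fun w => \sum_(i <- r) h i w).
Proof.
move=> bh; elim: r => [|i r IH].
  by under eq_fun do rewrite big_nil; exact: bounded_measurable_cst.
by under eq_fun do rewrite big_cons; exact: bounded_measurableD.
Qed.

Lemma le_expect h1 h2 : bounded_measurable h1 -> bounded_measurable h2 ->
  (forall w, h1 w <= h2 w) -> \int[P]_w h1 w <= \int[P]_w h2 w.
Proof.
move=> b1 b2 h12; apply: le_Rintegral => //; exact: bounded_measurable_integrable.
Qed.

Lemma expectD h1 h2 : bounded_measurable h1 -> bounded_measurable h2 ->
  \int[P]_w (h1 w + h2 w) = \int[P]_w h1 w + \int[P]_w h2 w.
Proof. by move=> b1 b2; rewrite RintegralD//; exact: bounded_measurable_integrable. Qed.

Lemma expectZ c h : bounded_measurable h ->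
  \int[P]_w (c * h w) = c * \int[P]_w h w.
Proof. by move=> b; rewrite RintegralZl//; exact: bounded_measurable_integrable. Qed.

Lemma expect_cst c : \int[P]_w c = c.
Proof. rewrite Rintegral_cst// -[RHS]mulr1; congr (_ * _).
exact: (congr1 fine (probability_setT P)). Qed.

Lemma expect_sum (I : Type) (r : seq I) (h : I -> Omega -> R) :
  (forall i, bounded_measurable (h i)) ->
  \int[P]_w (\sum_(i <- r) h i w) = \sum_(i <- r) \int[P]_w h i w.
Proof.
move=> bh; elim: r => [|i r IH].
  by rewrite big_nil; under eq_Rintegral do rewrite big_nil; rewrite expect_cst.
rewrite big_cons -IH; under eq_Rintegral do rewrite big_cons.
by rewrite expectD//; exact: bounded_measurable_sum.
Qed.

End BoundedExpectation.

(** * Summation inequalities for real sequences *)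

Section Telescoping.
Context {R : realType}.

(* The partial sums increase, so only an initial segment of indices counts. *)
Lemma sum_truncated_le (b : nat -> R) (a : R) n : 0 <= a -> (forall k, 0 <= b k) ->
  \sum_(k < n) b k * (\sum_(l < k.+1) b l <= a :> R)%R%:R <= a.
Proof.
(* The induction carries a second bound, by the full partial sum: when the newest index counts, the
   full sum is itself at most [a]. *)
move=> a0 b0; suff [] : \sum_(k < n) b k * (\sum_(l < k.+1) b l <= a :> R)%R%:R <= a /\
    \sum_(k < n) b k * (\sum_(l < k.+1) b l <= a :> R)%R%:R <= \sum_(l < n) b l by [].
elim: n => [|n [IH1 IH2]]; first by rewrite !big_ord0.
rewrite big_ord_recr /=; case: (leP (\sum_(l < n.+1) b l) a) => H; last first.
  rewrite mulr0 addr0; split => //; apply: le_trans IH2 _.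
  by rewrite big_ord_recr lerDl.
rewrite mulr1; suff H2 : \sum_(k < n) b k * (\sum_(l < k.+1) b l <= a :> R)%R%:R + b n <=
    \sum_(l < n.+1) b l by split=> //; exact: le_trans H2 H.
by rewrite [leRHS]big_ord_recr /= lerD2r.
Qed.

Lemma sum_half_powers_le n : \sum_(k < n) (2 : R)^-1 ^+ k <= 2.
Proof.
suff -> : \sum_(k < n) (2 : R)^-1 ^+ k = 2 - 2 * 2^-1 ^+ n.
  by rewrite gerBl mulr_ge0// exprn_ge0.
elim: n => [|n IH]; first by rewrite big_ord0 expr0; lra.
by rewrite big_ord_recr /= IH exprS; lra.
Qed.

(** Dividing by the activation probability gives [B] and [D] coefficient one for every player. This
    is the reason for the weights [(p i)^-1]. *)
Lemma scaled_step (q A B D : R) : 0 < q ->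
  A <= (1 - q) * B + q * D -> q^-1 * A + B <= q^-1 * B + D.
Proof.
move=> q0 H; rewrite -(ler_pM2l q0) !mulrDr !mulrA divff ?gt_eqF//.
by rewrite !mul1r; lra.
Qed.

(** The spectral norm of [Gamma] controls the terms [G i] only in total, so the contraction enters
    after summing over the players. *)
Lemma sum_scaled_step m (r A B G D : 'I_m -> R) (c K e : R) :
  (forall i, r i * A i + B i <= r i * B i + (G i + K * (D i + e))) ->
  \sum_i G i <= c * \sum_i B i ->
  \sum_i r i * A i + (1 - c) * \sum_i B i <=
  \sum_i r i * B i + K * (\sum_i D i + m%:R * e).
Proof.
move=> step sumG.
have := @ler_sum R _ (index_enum _) xpredT _ _ (fun i _ => step i).
rewrite !big_split /= -!mulr_sumr big_split /= sumr_const card_ord -mulr_natl.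
by move: sumG; lra.
Qed.

(** In the application [V k] and [W k] are the same quantity on the events [budget a k] and
    [budget a k.+1]; shrinking the event between two steps goes in the favourable direction. *)
Lemma sum_telescope (V W U D : nat -> R) c m :
  (forall k, V k.+1 + c * U k <= W k + D k) -> (forall k, W k <= V k) ->
  V m + c * \sum_(k < m) U k <= V 0%N + \sum_(k < m) D k.
Proof.
move=> step WV; elim: m => [|m IH]; first by rewrite !big_ord0 mulr0.
rewrite !big_ord_recr /=; have := step m; have := WV m; move: IH; lra.
Qed.

End Telescoping.

(** * The scheme on events of bounded cumulative error *)

Section Scheme.
Context {R : realType} {d : measure_display} {Omega : measurableType d}.
Context {P : probability Omega R} {N : nat} {n : 'I_N -> nat}.
Context {X : forall i : 'I_N, set 'rV[R]_(n i)} {f : 'I_N -> profile R n -> R}.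
Context {mu : R} {chi : 'I_N -> nat -> Omega -> bool}.
Context {F : nat -> set (set Omega)} {alpha : 'I_N -> nat -> Omega -> R}.
Context {x : nat -> Omega -> profile R n} {p : 'I_N -> R}.
Context (Hscheme : randomized_scheme P X f mu chi F alpha x).
Context (HR : assumption_R P chi F p).
Context (xs : profile R n) (C : R).
Context (C0 : 0 <= C) (XC : forall y, feasible X y -> enorm (y - xs) <= C).
Context (Gamma_lt1 : opnorm (Gamma X f mu) < 1).
Context (contr : forall i y, feasible X y ->
  enorm (prox_br X f mu i y - blk xs i) <=
  (bnorm (y - xs) *m (Gamma X f mu)^T) 0 i).

Lemma scheme_feasible k w : feasible X (x k w).
Proof.
elim: k => [|k IH] i; first exact: (S_init Hscheme).
case B : (chi i k w); first exact: (S_move Hscheme).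
by rewrite (S_stay Hscheme).
Qed.

Let sF k : is_sub_sigma_algebra (F k) := (S_filtration Hscheme k).1.

Lemma filtration_le k l : (k <= l)%N -> F k `<=` F l.
Proof.
move=> /subnK <-; elim: (l - k)%N => [//|j IH].
by apply: subset_trans IH _; rewrite addSn; exact: (S_filtration Hscheme _).2.
Qed.

Definition dist i k w : R := bnorm (x k w - xs) 0 i.
(* An upper bound of |xhat_i(x_k) - x_i^*|. *)
Definition cdist i k w : R := (bnorm (x k w - xs) *m (Gamma X f mu)^T) 0 i.

Lemma distE i k w : dist i k w = enorm (blk (x k w) i - blk xs i).
Proof. by rewrite /dist mxE blkD blkN. Qed.

Lemma dist_ge0 i k w : 0 <= dist i k w.
Proof. by rewrite distE enorm_ge0. Qed.

Lemma dist_le i k w : dist i k w <= C.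
Proof.
rewrite /dist mxE; apply: le_trans (enorm_blk _ _) _.
exact/XC/scheme_feasible.
Qed.

Lemma cdist_ge0 i k w : 0 <= cdist i k w.
Proof. exact: le_trans (enorm_ge0 _) (contr _ (scheme_feasible k w)). Qed.

Lemma sum_cdist_le k w : \sum_i cdist i k w ^+ 2 <=
  opnorm (Gamma X f mu) ^+ 2 * \sum_i dist i k w ^+ 2.
Proof.
have sumE (v : 'rV[R]_N) : \sum_i v 0 i ^+ 2 = enorm v ^+ 2.
  by rewrite enorm_sqr; apply: eq_bigr => i _; rewrite expr2.
rewrite !sumE -exprMn ler_sqr ?nnegrE ?mulr_ge0 ?opnorm_ge0 ?enorm_ge0//.
exact: enorm_mulmx_tr.
Qed.

Lemma cdist_le i k w : cdist i k w <= C.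
Proof.
apply: le_trans (ler_norm _) _; apply: le_trans (enorm_coord _ _) _.
apply: le_trans (enorm_mulmx_tr _ _) _; rewrite enorm_bnorm.
have := XC (scheme_feasible k w).
have := enorm_ge0 (x k w - xs); have := opnorm_ge0 (Gamma X f mu).
move: Gamma_lt1 C0; nra.
Qed.

Lemma measurable_dist i k : measurable_wrt (F k) (dist i k).
Proof.
apply/(measurable_wrtP (sF k)).
have -> : dist i k = Num.sqrt \o (fun w =>
    \sum_(j < n i) (x k w 0 (tagnat.Rank i j) - blk xs i 0 j) ^+ 2).
  apply/funext => w; rewrite distE /=; congr Num.sqrt.
  by apply: eq_bigr => j _; rewrite !mxE.
apply: measurableT_comp; first exact: (continuous_measurable_fun (@sqrt_continuous R)).
apply: measurable_sum => j; apply: measurable_funX; apply: measurable_funB => //.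
exact/(measurable_wrtP (sF k))/(S_adapted Hscheme).
Qed.

Lemma measurable_cdist i k : measurable_wrt (F k) (cdist i k).
Proof.
apply/(measurable_wrtP (sF k)).
have -> : cdist i k = (fun w => \sum_j dist j k w * (Gamma X f mu) i j).
  by apply/funext => w; rewrite /cdist mxE; apply: eq_bigr => j _; rewrite [_^T _ _]mxE.
apply: measurable_sum => j; apply: measurable_funM => //.
exact/(measurable_wrtP (sF k))/measurable_dist.
Qed.


Lemma bounded_measurable_wrt k (h : Omega -> R) M :
  measurable_wrt (F k) h -> (forall w, 0 <= h w <= M) -> bounded_measurable h.
Proof.
move=> mh hM; split; first exact: measurable_wrt_measurable mh.
by exists M => w; have /andP[h0 hw] := hM w; rewrite ger0_norm.
Qed.

Lemma bounded_measurable_indic k (S : set Omega) : F k S ->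
  bounded_measurable (\1_S : Omega -> R).
Proof.
move=> FS; split; first by apply: measurable_indic; exact: (sF k).2.
by exists 1 => w; rewrite indicE; case: (_ \in _); rewrite ?normr1 ?normr0.
Qed.

Let bm_dist2 i k : bounded_measurable (fun w => dist i k w ^+ 2).
Proof.
have b : bounded_measurable (dist i k).
  apply: (bounded_measurable_wrt (M := C) (@measurable_dist i k)) => w.
  by rewrite dist_ge0 dist_le.
by under eq_fun do rewrite expr2; exact: bounded_measurableM.
Qed.

Let bm_cdist2 i k : bounded_measurable (fun w => cdist i k w ^+ 2).
Proof.
have b : bounded_measurable (cdist i k).
  apply: (bounded_measurable_wrt (M := C) (@measurable_cdist i k)) => w.
  by rewrite cdist_ge0 cdist_le.
by under eq_fun do rewrite expr2; exact: bounded_measurableM.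
Qed.

Lemma bounded_alpha_indic i k (S : set Omega) (a : R) : F k S -> 0 <= a ->
  (forall w, S w -> alpha i k w <= a) ->
  bounded_measurable (fun w => alpha i k w * \1_S w).
Proof.
move=> FS a0 aS; have [ma al0] := S_alpha Hscheme i k.
have [mS _] := bounded_measurable_indic FS; split.
  by apply: measurable_funM => //; exact: measurable_wrt_measurable ma.
exists a => w; have [Sw|Sw] := pselect (S w); last first.
  by rewrite indicE memNset// mulr0 normr0.
by rewrite indicE mem_set// mulr1 ger0_norm// aS.
Qed.

(* [sqE i k S] is E[|x_{i,k} - x_i^*|^2 ; S]. *)
Definition sqE i k (S : set Omega) : R := \int[P]_w (dist i k w ^+ 2 * \1_S w).
Definition alphaE i k (S : set Omega) : R := \int[P]_w (alpha i k w * \1_S w).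

(** The triangle inequality through the exact best response gives the form required by
    [one_step_le], whose [eps] is taken to be [2^-1 ^+ k] so as to be summable in [k]. *)
Lemma expected_step i k (S : set Omega) (a : R) : F k S -> 0 <= a ->
  (forall w, S w -> alpha i k w <= a) ->
  sqE i k.+1 S <= (1 - p i) * sqE i k S +
    p i * (\int[P]_w (cdist i k w ^+ 2 * \1_S w) +
           (a + 2 * C) * (alphaE i k S + 2^-1 ^+ k)).
Proof.
move=> FS a0 aS; have [p0 /(_ k) [Pchi indep]] := HR i.
have [mchi _ _] := S_iid Hscheme i.
have [Y condY Yal] := S_error Hscheme i k.
have [ma al0] := S_alpha Hscheme i k.
have bS := bounded_measurable_indic FS.
have eps0 : 0 < (2 : R)^-1 ^+ k by rewrite exprn_gt0.
have gC w : 0 <= cdist i k w <= C by rewrite cdist_ge0 cdist_le.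
have stay w : chi i k w = false -> dist i k.+1 w = dist i k w.
  by move=> B; rewrite !distE (S_stay Hscheme).
have moves w : chi i k w = true -> dist i k.+1 w <=
    enorm (blk (x k.+1 w) i - prox_br X f mu i (x k w)) + cdist i k w.
  move=> _; rewrite distE -(subrK (prox_br X f mu i (x k w)) (blk (x k.+1 w) i)).
  rewrite -addrA; apply: le_trans (enormD _ _) _; rewrite addrK lerD2l.
  by apply: contr; exact: scheme_feasible.
have bal := bounded_alpha_indic FS a0 aS.
have bU l : bounded_measurable (fun w => dist i l w ^+ 2 * \1_S w).
  exact: bounded_measurableM.
have bG : bounded_measurable (fun w => cdist i k w ^+ 2 * \1_S w).
  exact: bounded_measurableM.
have be : bounded_measurable (fun w => 2^-1 ^+ k * \1_S w : R).
  by apply: bounded_measurableM => //; exact: bounded_measurable_cst.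
have bD : bounded_measurable (fun w => alpha i k w * \1_S w + 2^-1 ^+ k * \1_S w).
  exact: bounded_measurableD.
have bK : bounded_measurable (fun w => (a + 2 * C) *
    (alpha i k w * \1_S w + 2^-1 ^+ k * \1_S w)).
  by apply: bounded_measurableM => //; exact: bounded_measurable_cst.
have H := @one_step_le R d Omega P (F k) (sF k) (chi i k) (p i)
  (fun w => enorm (blk (x k.+1 w) i - prox_br X f mu i (x k w)))
  (alpha i k) (dist i k) (dist i k.+1) (cdist i k) Y S a C (2^-1 ^+ k)
  (mchi k) Pchi indep condY Yal ma (@measurable_dist i k)
  (@measurable_cdist i k)
  (measurable_wrt_measurable (sF k.+1) (@measurable_dist i k.+1)) FS
  (fun w => enorm_ge0 _) al0 (dist_ge0 i k.+1) gC eps0 aS a0 stay moves.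
have E : (fun w => (cdist i k w ^+ 2 + (a + 2 * C) * (alpha i k w + 2^-1 ^+ k)) * \1_S w)
    = (fun w => cdist i k w ^+ 2 * \1_S w + (a + 2 * C) *
    (alpha i k w * \1_S w + 2^-1 ^+ k * \1_S w)).
  by apply/funext => w; ring.
move: H; rewrite (eq_integral _ _ (fun w _ => congr1 (fun h => (h w)%:E) E)).
rewrite -!EFin_Rintegral//; last exact: bounded_measurableD.
rewrite -!EFinM -EFinD lee_fin => H; apply: le_trans H _.
rewrite lerD2l ler_wpM2l ?(ltW p0)// expectD// lerD2l expectZ//.
apply: ler_wpM2l; first by rewrite addr_ge0// mulr_ge0.
rewrite expectD// lerD2l -[leRHS](expect_cst P); apply: le_expect => //.
  exact: bounded_measurable_cst.
by move=> w; rewrite indicE; case: (_ \in _); rewrite ?mulr1 ?mulr0// ltW.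
Qed.

Definition lyapunov k S : R := \sum_i (p i)^-1 * sqE i k S.

Let p_gt0 i : 0 < p i. Proof. by have [] := HR i. Qed.

Lemma sqE_ge0 i k S : 0 <= sqE i k S.
Proof. by apply: Rintegral_ge0 => w _; rewrite mulr_ge0// sqr_ge0. Qed.

Lemma lyapunov_ge0 k S : 0 <= lyapunov k S.
Proof. by apply: sumr_ge0 => i _; rewrite mulr_ge0 ?sqE_ge0// invr_ge0 ltW. Qed.

Lemma sqE_le i k S S' : F k S -> F k S' -> S `<=` S' -> sqE i k S <= sqE i k S'.
Proof.
move=> FS FS' SS'; apply: le_expect.
- by apply: bounded_measurableM => //; exact: bounded_measurable_indic FS.
- by apply: bounded_measurableM => //; exact: bounded_measurable_indic FS'.
move=> w; apply: ler_wpM2l; first exact: sqr_ge0.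
rewrite !indicE ler_nat; have [Sw|Sw] := pselect (S w); last by rewrite memNset.
by rewrite !mem_set//; exact: SS'.
Qed.

Lemma lyapunov_le k S S' : F k S -> F k S' -> S `<=` S' ->
  lyapunov k S <= lyapunov k S'.
Proof.
move=> FS FS' SS'; apply: ler_sum => i _.
by apply: ler_wpM2l; [rewrite invr_ge0 ltW|exact: sqE_le].
Qed.

Lemma lyapunov_step k (S : set Omega) (a : R) : F k S -> 0 <= a ->
  (forall w, S w -> \sum_i alpha i k w <= a) ->
  lyapunov k.+1 S + (1 - opnorm (Gamma X f mu) ^+ 2) * (\sum_i sqE i k S) <=
  lyapunov k S + (a + 2 * C) * (\sum_i alphaE i k S + N%:R * 2^-1 ^+ k).
Proof.
move=> FS a0 aS.
have bS := bounded_measurable_indic FS.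
pose G i := \int[P]_w (cdist i k w ^+ 2 * \1_S w).
have sumG : \sum_i G i <= opnorm (Gamma X f mu) ^+ 2 * \sum_i sqE i k S.
  rewrite -!expect_sum; try by move=> i; exact: bounded_measurableM.
  rewrite -expectZ; last first.
    by apply: bounded_measurable_sum => i; exact: bounded_measurableM.
  apply: le_expect.
  - by apply: bounded_measurable_sum => i; exact: bounded_measurableM.
  - apply: bounded_measurableM; first exact: bounded_measurable_cst.
    by apply: bounded_measurable_sum => i; exact: bounded_measurableM.
  move=> w; rewrite -!mulr_suml mulrA; apply: ler_wpM2r => //.
  exact: sum_cdist_le.
apply: sum_scaled_step sumG => i; apply: scaled_step => //.
apply: expected_step => // w Sw; apply: le_trans (aS w Sw).
rewrite (bigD1 i)//= lerDl.
by apply: sumr_ge0 => j _; exact: (S_alpha Hscheme j k).2.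
Qed.

(* Restricting to these decreasing adapted events plays the role of a stopping
   time for the random series of errors. *)
Definition budget (a : R) k : set Omega :=
  [set w | \sum_(l < k) \sum_i alpha i l w <= a].

(** [budget a k] involves only errors of index below [k]. Thus [budget a k.+1], which already
    restrains the error at time [k], is known at time [k] and can weight that step. *)
Lemma budget_adapted a k l : (k <= l.+1)%N -> F l (budget a k).
Proof.
move=> kl; pose h w := \sum_(j < k) \sum_i alpha i j w.
have mh : measurable_wrt (F l) h.
  apply/(measurable_wrtP (sF l)); apply: measurable_sum => j.
  apply: measurable_sum => i; apply/(measurable_wrtP (sF l)).
  apply: measurable_wrt_sub (S_alpha Hscheme i j).1; apply: filtration_le.
  by rewrite -ltnS; exact: leq_trans (ltn_ord j) kl.
apply: mh; exists `]-oo, a]%classic => //.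
by rewrite setTI; apply/seteqP; split => w; rewrite /= in_itv.
Qed.

Lemma budgetS a k : budget a k.+1 `<=` budget a k.
Proof.
move=> w; rewrite /budget /= big_ord_recr /=; apply: le_trans; rewrite lerDl.
by apply: sumr_ge0 => j _; exact: (S_alpha Hscheme j k).2.
Qed.

Lemma budget_step_le a k w : 0 <= a -> budget a k.+1 w ->
  \sum_i alpha i k w <= a.
Proof.
move=> a0; rewrite /budget /= big_ord_recr /=; apply: le_trans; rewrite lerDr.
by do 2![apply: sumr_ge0 => ? _]; exact: (S_alpha Hscheme _ _).2.
Qed.

(** Holds outcome by outcome, by [sum_truncated_le], before expectations are taken. *)
Lemma sum_alphaE_le a m : 0 <= a ->
  \sum_(k < m) \sum_i alphaE i k (budget a k.+1) <= a.
Proof.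
move=> a0.
have b i k : bounded_measurable
    (fun w => alpha i k w * \1_(budget a k.+1) w).
  apply: (@bounded_alpha_indic i k _ a); [exact: budget_adapted|by []|].
  move=> w /(budget_step_le a0); apply: le_trans; rewrite (bigD1 i)//= lerDl.
  by apply: sumr_ge0 => j _; exact: (S_alpha Hscheme j k).2.
under eq_bigr do rewrite -expect_sum//.
rewrite -expect_sum; last by move=> k; exact: bounded_measurable_sum.
rewrite -[leRHS](expect_cst P); apply: le_expect.
- by apply: bounded_measurable_sum => k; exact: bounded_measurable_sum.
- exact: bounded_measurable_cst.
move=> w; apply: le_trans (@sum_truncated_le R
  (fun k => \sum_i alpha i k w) a m a0 _); last first.
  by move=> k; apply: sumr_ge0 => i _; exact: (S_alpha Hscheme _ _).2.
apply: ler_sum => k _; rewrite -mulr_suml le_eqVlt; apply/orP; left.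
apply/eqP; congr (_ * _); rewrite indicE; congr (_%:R).
congr (nat_of_bool _).
by apply/idP/idP => [/set_mem|H]; [|exact: mem_set].
Qed.

Lemma sum_sqE_telescope a m : 0 <= a ->
  lyapunov m (budget a m) + (1 - opnorm (Gamma X f mu) ^+ 2) *
    (\sum_(k < m) \sum_i sqE i k (budget a k.+1)) <=
  lyapunov 0 (budget a 0) + (a + 2 * C) *
    (\sum_(k < m) (\sum_i alphaE i k (budget a k.+1) + N%:R * 2^-1 ^+ k)).
Proof.
move=> a0; rewrite [X in _ <= _ + X]mulr_sumr.
apply: (@sum_telescope R (fun k => lyapunov k (budget a k))
  (fun k => lyapunov k (budget a k.+1))
  (fun k => \sum_i sqE i k (budget a k.+1))
  (fun k => (a + 2 * C) *
    (\sum_i alphaE i k (budget a k.+1) + N%:R * 2^-1 ^+ k))) => k.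
  by apply: lyapunov_step => //; [exact: budget_adapted|move=> w; exact: budget_step_le].
by apply: lyapunov_le; [exact: budget_adapted|exact/budget_adapted/leqnSn|exact: budgetS].
Qed.

Lemma sum_sqE_bounded a : 0 <= a ->
  exists M, forall m, \sum_(k < m) \sum_i sqE i k (budget a k.+1) <= M.
Proof.
move=> a0; have c2 : 0 < 1 - opnorm (Gamma X f mu) ^+ 2.
  have := opnorm_ge0 (Gamma X f mu); move: Gamma_lt1.
  by move: (opnorm _) => c; nra.
(* In the telescoped bound the errors contribute at most [a], and the geometric slacks at most 2 for
   each player. *)
exists ((lyapunov 0 (budget a 0) + (a + 2 * C) * (a + N%:R * 2)) /
  (1 - opnorm (Gamma X f mu) ^+ 2)) => m.
rewrite ler_pdivlMr// mulrC.
have := sum_sqE_telescope m a0; have := lyapunov_ge0 m (budget a m).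
suff : (a + 2 * C) * (\sum_(k < m) (\sum_i alphaE i k (budget a k.+1) +
    N%:R * 2^-1 ^+ k)) <= (a + 2 * C) * (a + N%:R * 2) by lra.
apply: ler_wpM2l; first by rewrite addr_ge0// mulr_ge0.
rewrite big_split /= lerD ?sum_alphaE_le// -mulr_sumr.
by apply: ler_wpM2l => //; exact: sum_half_powers_le.
Qed.

(** Sum and integral are exchanged for nonnegative terms; a nonnegative series of finite expectation
    is almost surely finite. *)
Lemma ae_budget_summable a : 0 <= a -> {ae P, forall w,
  (\sum_(0 <= k <oo) ((\sum_i dist i k w ^+ 2) * \1_(budget a k.+1) w)%:E < +oo)%E}.
Proof.
move=> a0; have [M HM] := sum_sqE_bounded a0.
pose h k w := (\sum_i dist i k w ^+ 2) * \1_(budget a k.+1) w.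
have bi i k : bounded_measurable
    (fun w => dist i k w ^+ 2 * \1_(budget a k.+1) w).
  by apply: bounded_measurableM => //; apply: bounded_measurable_indic; exact: budget_adapted.
have hE k : h k = (fun w => \sum_i dist i k w ^+ 2 * \1_(budget a k.+1) w).
  by apply/funext => w; rewrite /h mulr_suml.
have bh k : bounded_measurable (h k).
  by rewrite hE; exact: bounded_measurable_sum.
have mh k : measurable_fun setT (fun w => (h k w)%:E).
  by apply/measurable_EFinP; exact: (bh k).1.
have h0 k w : (0 <= (h k w)%:E)%E.
  by rewrite lee_fin mulr_ge0// sumr_ge0// => i _; exact: sqr_ge0.
have Ih k : (\int[P]_w (h k w)%:E = (\sum_i sqE i k (budget a k.+1))%:E)%E.
  by rewrite -EFin_Rintegral// hE expect_sum.
have intM : (\int[P]_w (\sum_(0 <= k <oo) (h k w)%:E) <= M%:E)%E.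
  rewrite integral_nneseries//.
  apply: lime_le; first by apply: is_cvg_nneseries => k _ _; exact: integral_ge0.
  apply: nearW => m; under eq_bigr do rewrite Ih.
  by rewrite sumEFin lee_fin big_mkord.
have int : P.-integrable setT (fun w => \sum_(0 <= k <oo) (h k w)%:E)%E.
  apply/integrableP; split; first by apply: ge0_emeasurable_sum.
  apply: le_lt_trans (ltry M); apply: le_trans intM.
  by under eq_integral do rewrite gee0_abs ?nneseries_ge0//.
have := integrable_ae measurableT int.
apply: filterS => w /(_ I) fin_w.
by rewrite ltey_eq fin_w.
Qed.

(** Purely pathwise. An integer [a] above the total error puts [w] in every [budget a k], so all
    indicators equal one; the squared distances are then summable and tend to zero. *)
Lemma cvg_dist w : (forall i, \sum_(0 <= k <oo) (alpha i k w)%:E < +oo)%E ->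
  (forall a : nat, \sum_(0 <= k <oo)
     ((\sum_i dist i k w ^+ 2) * \1_(budget a%:R k.+1) w)%:E < +oo)%E ->
  forall i, (fun k => blk (x k w) i) @ \oo --> blk xs i.
Proof.
move=> sum_alpha sum_dist i.
have al0 j k : 0 <= alpha j k w by exact: (S_alpha Hscheme j k).2.
have partial_le (b : nat -> R) : (forall k, 0 <= b k) ->
    (\sum_(0 <= k <oo) (b k)%:E < +oo)%E ->
    forall m, \sum_(k < m) b k <= fine (\sum_(0 <= k <oo) (b k)%:E)%E.
  move=> b0 bf m; rewrite -lee_fin fineK; last first.
    by rewrite ge0_fin_numE// nneseries_ge0// => k _ _; rewrite lee_fin.
  rewrite -sumEFin -(big_mkord xpredT (fun k => (b k)%:E)).
  by apply: nneseries_lim_ge => k _ _; rewrite lee_fin.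
pose M := \sum_j fine (\sum_(0 <= k <oo) (alpha j k w)%:E)%E.
have [a Ma] : exists a : nat, M <= a%:R.
  by exists (Num.truncn M).+1; apply: ltW; exact: truncnS_gt.
have in_budget k : budget a%:R k w.
  rewrite /budget /=; apply: le_trans Ma; rewrite exchange_big /=.
  by apply: ler_sum => j _; exact: partial_le.
pose h k := \sum_i dist i k w ^+ 2.
have h0 k : 0 <= h k by apply: sumr_ge0 => j _; exact: sqr_ge0.
have hf : (\sum_(0 <= k <oo) (h k)%:E < +oo)%E.
  have := sum_dist a; under eq_eseriesr do rewrite indicE mem_set// mulr1.
  by [].
have h_cvg : h @ \oo --> 0.
  apply: cvg_series_cvg_0; apply: nondecreasing_is_cvgn.
    by apply/nondecreasing_seqP => k; rewrite !seriesEnat /= big_nat_recr//= lerDl.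
  exists (fine (\sum_(0 <= k <oo) (h k)%:E)%E) => _ [k _ <-].
  by rewrite seriesEnat /= big_mkord; exact: partial_le.
apply/cvgrPdist_lt => e e0.
have e2 : 0 < e ^+ 2 by rewrite exprn_gt0.
move/cvgrPdist_lt : h_cvg => /(_ _ e2); apply: filterS => k.
rewrite sub0r normrN ger0_norm// => hk.
apply: le_lt_trans (mxnorm_enorm _) _; rewrite -enormN opprB -distE.
rewrite -ltr_sqr ?nnegrE ?dist_ge0 ?(ltW e0)//; apply: le_lt_trans hk.
rewrite /h (bigD1 i)//= lerDl.
by apply: sumr_ge0 => j _; exact: sqr_ge0.
Qed.

End Scheme.

Theorem lemma4 (R : realType) (d : measure_display) (Omega : measurableType d)
    (P : probability Omega R)
    (N : nat) (n : 'I_N -> nat) (n_gt0 : forall i, (0 < n i)%N)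
    (X : forall i : 'I_N, set 'rV[R]_(n i))
    (m : nat) (xi : Omega -> 'rV[R]_m)
    (xi_rv : vec_measurable_wrt measurable xi)
    (psi : 'I_N -> profile R n -> 'rV[R]_m -> R)
    (mu : R) (mu_gt0 : 0 < mu)
    (HA : forall i, assumption_A P X xi psi i)
    (HB : assumption_B X (cost P xi psi) mu)
    (chi : 'I_N -> nat -> Omega -> bool) (F : nat -> set (set Omega))
    (alpha : 'I_N -> nat -> Omega -> R) (x : nat -> Omega -> profile R n)
    (p : 'I_N -> R)
    (Hscheme : randomized_scheme P X (cost P xi psi) mu chi F alpha x)
    (HR : assumption_R P chi F p)
    (Halpha : forall i, {ae P, forall w,
      (forall k, 0 <= alpha i k w < 1) /\
      (\sum_(0 <= k <oo) (alpha i k w)%:E < +oo)%E}) :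
  exists xs : profile R n,
    [/\ is_nash X (cost P xi psi) xs,
        forall ys, is_nash X (cost P xi psi) ys -> ys = xs
      & forall i, {ae P, forall w,
          (fun k => blk (x k w) i) @ \oo --> blk xs i}].
Proof.
case: HB => zmin zmax Gamma_lt1.
have HG : smooth_convex_game X (cost P xi psi).
  split.
  - exact: n_gt0.
  - by move=> i; exact: A_nonempty (HA i).
  - by move=> i; exact: A_compact (HA i).
  - by move=> i; exact: A_convex (HA i).
  - move=> i y Xy.
    have [U [[oU _] XU _ cU [dU _]]] := A_own (HA i) (fun j _ => Xy j).
    by exists U.
  - move=> i; have [V [_ XV _ dV]] := A_joint (HA i).
    by exists V.
have [xs Xxs [fix_xs nash_xs]] := unique_nash HG zmin zmax mu_gt0 Gamma_lt1.
exists xs; split; [exact: nash_xs.1|exact: nash_xs.2|].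
have [C0 XC0] := feasible_bounded HG.
pose C := C0 + enorm xs.
have XC y : feasible X y -> enorm (y - xs) <= C.
  by move=> Xy; rewrite (le_trans (enormD _ _))// enormN lerD2r XC0.
have C_ge0 : 0 <= C := le_trans (enorm_ge0 _) (XC _ Xxs).
(* The general contraction bound is specialized at [xs], whose blocks are their own proximal
   responses. *)
have contr i y : feasible X y ->
    enorm (prox_br X (cost P xi psi) mu i y - blk xs i) <=
    (bnorm (y - xs) *m (Gamma X (cost P xi psi) mu)^T) 0 i.
  move=> Xy; have := argmin_prox_contraction HG zmin zmax mu_gt0 Xy Xxs
    (prox_brP HG mu i Xy) (prox_brP HG mu i Xxs).
  by rewrite -{1}(blk_xhat X (cost P xi psi) mu xs i) fix_xs.
(* Only integer budgets are used, so that the exceptional null sets are countably many. *)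
have summable (a : nat) := ae_budget_summable Hscheme HR C_ge0 XC Gamma_lt1 contr
  (ler0n R a).
have sum_alpha : {ae P, forall w, forall i,
    (\sum_(0 <= k <oo) (alpha i k w)%:E < +oo)%E}.
  by apply: filter_forall => i; apply: filterS (Halpha i) => w [].
move=> i; apply: filterS2 (ae_foralln summable) sum_alpha => w sum_dist sum_al.
exact: (cvg_dist Hscheme sum_al sum_dist).
Qed.
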